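(* Let $\psi\in C^0([0,1])$ satisfy $\psi(x)=\psi(1-x)$ for all $x\in(0,1)$, $\psi(0)=\psi(1)<0$, and $\psi(x_0)>0$ for some $x_0\in(0,1)$. Assume that $$\inf_{v\in\mathcal M(\psi)}W(v)<4c_0^2 .$$ Then there exists $u\in\mathcal M(\psi)$ such that $$W(u)=\inf_{v\in\mathcal M(\psi)}W(v).$$
   Context: For $v\in H^2(0,1)$ the elastica functional is $$W(v)=\int_0^1\frac{v''(x)^2}{(1+v'(x)^2)^{5/2}}\,dx .$$ The admissible set is $$\mathcal M(\psi)=\{v\in H^2_0(0,1)\mid v(x)=v(1-x),\ v(x)\ge\psi(x)\ \text{for all }x\in(0,1)\},$$ where $H^2_0(0,1)$ is the set of $v\in H^2(0,1)$ with $v(0)=v(1)=0$ and $v'(0)=v'(1)=0$. The constant $c_0$ is $$c_0=\int_{\mathbb R}\frac{d\tau}{(1+\tau^2)^{5/4}}=\sqrt\pi\,\frac{\Gamma(3/4)}{\Gamma(5/4)}.$$ *)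

(* Defs.v *)
From mathcomp Require Import all_boot all_order all_algebra.
From mathcomp Require Import all_classical all_reals all_analysis.

Set Implicit Arguments.
Unset Strict Implicit.
Unset Printing Implicit Defensive.

Import Order.TTheory GRing.Theory Num.Theory.
Import numFieldNormedType.Exports.

Local Open Scope classical_set_scope.
Local Open Scope ring_scope.

Section Elastica.
Context {R : realType}.
Implicit Types f g v phi psi : R -> R.

Local Notation mu := (@lebesgue_measure R).

(* Functions on (0,1) or [0,1] are represented by total functions R -> R; no
   definition below depends on their values outside [0,1]. *)

Definition smooth phi : Prop := forall n x, derivable (derive1n n phi) x 1.

Definition test_function phi : Prop :=
  let supp := closure [set x | phi x != 0] in
  [/\ smooth phi, compact supp & supp `<=` `]0, 1[].

Definition is_weak_derivative f g : Prop :=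
  forall phi, test_function phi ->
    (\int[mu]_(x in `]0, 1[) (f x * derive1 phi x) =
     - \int[mu]_(x in `]0, 1[) (g x * phi x))%R.

Definition L2 f : Prop :=
  (f \_ `]0, 1[ : measurableTypeR R -> R) \in Lfun mu 2%:E.

Definition H1 f : Prop :=
  L2 f /\ exists2 g, L2 g & is_weak_derivative f g.

(* A representative of the weak derivative, which is unique up to equality
   almost everywhere on (0,1); junk unless f is in H1. *)
Definition weak_derivative f : R -> R :=
  xget (fun=> 0) [set g | L2 g /\ is_weak_derivative f g].

Definition H2 f : Prop := H1 f /\ H1 (weak_derivative f).

Definition continuous_representative f g : Prop :=
  {within `[0, 1], continuous g} /\ ae_eq mu `]0, 1[%classic f g.

(* An element of H^2 is identified with its continuous representative, and so
   is its derivative when it is evaluated at the end points. *)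
Definition H20 v : Prop :=
  [/\ {within `[0, 1], continuous v}, H2 v, v 0 = 0 /\ v 1 = 0 &
      exists2 v', continuous_representative (weak_derivative v) v' &
                  v' 0 = 0 /\ v' 1 = 0].

Definition W v : \bar R :=
  (\int[mu]_(x in `]0%R, 1%R[)
    ((weak_derivative (weak_derivative v) x) ^+ 2 /
     (1 + (weak_derivative v x) ^+ 2) `^ (5 / 2))%:E)%E.

Definition M psi : set (R -> R) :=
  [set v | [/\ H20 v,
               forall x, x \in `]0, 1[ -> v x = v (1 - x) &
               forall x, x \in `]0, 1[ -> psi x <= v x]].

End Elastica.

Definition c0 (R : realType) : R :=
  (\int[@lebesgue_measure R]_tau ((1 + tau ^+ 2) `^ (5 / 4))^-1)%R.

(* Main.v *)
(** Let G(s) be the integral of (1 + t^2)^(-5/4) over [0, s]; it increases from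
    - c0/2 to c0/2. If p = v' is the slope of v, then w = G(p) has derivative
    w' = v'' (1 + p^2)^(-5/4), so that W(v) is the Dirichlet energy of w. For an
    admissible v the symmetry makes w vanish at 0, 1/2 and 1 and w(1 - x) =
    - w(x), whence 16 w(x)^2 <= W(v) by the Cauchy-Schwarz inequality. So the
    energy bound W(v) <= K < 4 c0^2 keeps w away from - c0/2 and c0/2, that is,
    it bounds the slope p. Along a minimizing sequence the slopes are therefore
    bounded and equi-Hoelder, and have a uniform cluster point p. The Dirichlet
    energy being lower semicontinuous under uniform convergence, G(p) is the
    primitive of a square integrable function, with energy at most the infimum;
    inverting G by the chain rule, p is the primitive of a square integrable
    function too, and u(x), the integral of p over [0, x], is a minimizer. *)
Require Import Defs.
From mathcomp Require Import all_boot all_order all_algebra.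
From mathcomp Require Import all_classical all_reals all_analysis.
From mathcomp Require Import measurable_realfun ring lra.
Import Order.TTheory GRing.Theory Num.Theory.
Import numFieldNormedType.Exports.
Local Open Scope classical_set_scope.
Local Open Scope ring_scope.

Set Implicit Arguments.
Unset Strict Implicit.
Unset Printing Implicit Defensive.

(** * Integration over closed segments *)

Section IntegralOnSegments.
Context {R : realType}.
Implicit Types (f g h : R -> R) (a b c x y : R).
Local Notation mu := (@lebesgue_measure R).

(** The weight in [W] decays as the slope grows, so bounded energy does not by itself bound [v''] in
    L^2; straightening the functional by G and bounding the slope restores coercivity. The threshold
    is the value at which this works: the constraint 16 w^2 <= K forces |w| < c0/2 exactly when K <
    4 c0^2.

    The limit slope is at first only a uniform cluster point, with no derivative of any kind. For
    this reason chain and product rules are stated for increments: an error bounded by the length of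
    the interval times the increment of some function adds up to zero over fine partitions. This
    handles derivatives that are merely square integrable, and it also allows G to be inverted.

    Lower semicontinuity comes from convexity rather than from weak compactness: almost minimizers
    of the energy among functions whose primitive is uniformly close to G(p) are Cauchy in L^2 by
    the parallelogram law.

    Since [weak_derivative] is an arbitrary choice of representative, the du Bois-Reymond lemma and
    Lebesgue differentiation are needed to pass between weak derivatives and primitives. *)

Definition int_on a b g := mu.-integrable `[a, b] (EFin \o g).

Definition L2_on a b g :=
  measurable_fun `[a, b] g /\ int_on a b (fun x => g x ^+ 2).

Definition integral_from_to a b g := \int[mu]_(t in `[a, b]) g t.
Local Notation J := integral_from_to.

Lemma int_onS a b x y g : a <= x -> y <= b -> int_on a b g -> int_on x y g.
Proof.
move=> ax yb; apply: integrableS => //; apply: subset_itv; rewrite bnd_simp//.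
Qed.

Lemma L2_onS a b x y g : a <= x -> y <= b -> L2_on a b g -> L2_on x y g.
Proof.
move=> ax yb [mg ig]; split; last exact: int_onS ig.
by apply: measurable_funS mg => //; apply: subset_itv; rewrite bnd_simp.
Qed.

Lemma int_on_cst a b c : int_on a b (fun=> c).
Proof.
apply: continuous_compact_integrable; first exact: segment_compact.
by move=> z; exact: cvg_cst.
Qed.

Lemma int_onD a b f g : int_on a b f -> int_on a b g ->
  int_on a b (fun x => f x + g x).
Proof. by move=> iF ig; have := @integrableD _ _ _ mu `[a, b] (measurable_itv _) _ _ iF ig. Qed.

Lemma int_onB a b f g : int_on a b f -> int_on a b g ->
  int_on a b (fun x => f x - g x).
Proof. by move=> iF ig; have := @integrableB _ _ _ mu `[a, b] (measurable_itv _) _ _ iF ig. Qed.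

Lemma int_onZ a b c g : int_on a b g -> int_on a b (fun x => c * g x).
Proof. by move=> ig; have := @integrableZl _ _ _ mu `[a, b] (measurable_itv _) c _ ig. Qed.

Lemma int_on_norm a b g : int_on a b g -> int_on a b (fun x => `|g x|).
Proof. by move=> ?; exact: integrable_norm. Qed.

Lemma int_on_cont a b g : {within `[a, b], continuous g} -> int_on a b g.
Proof. by apply: continuous_compact_integrable; exact: segment_compact. Qed.

Lemma int_on_meas a b g : int_on a b g -> measurable_fun `[a, b] g.
Proof. by move=> /integrableP[/measurable_EFinP]. Qed.

Lemma meas_cont a b g : {within `[a, b], continuous g} ->
  measurable_fun `[a, b] g.
Proof. by move=> /int_on_cont/int_on_meas. Qed.

Lemma int_on_le a b f g : measurable_fun `[a, b] f -> int_on a b g ->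
  (forall x, a <= x <= b -> `|f x| <= g x) -> int_on a b f.
Proof.
move=> mf ig fg; apply: le_integrable ig => //; first exact/measurable_EFinP.
move=> x /=; rewrite in_itv/= => xab; rewrite lee_fin (le_trans (fg _ xab))//.
exact: ler_norm.
Qed.

Lemma L2_on_int a b g : L2_on a b g -> int_on a b g.
Proof.
move=> [mg ig]; apply: (@int_on_le _ _ _ (fun x => 1 + g x ^+ 2)) => //.
  exact/int_onD/ig/int_on_cst.
move=> x _; rewrite -[X in _ + X]real_normK ?num_real//.
have : 0 <= (`|g x| - 1) ^+ 2 by exact: sqr_ge0.
have := normr_ge0 (g x); nra.
Qed.

Lemma L2_on_cont a b g : {within `[a, b], continuous g} -> L2_on a b g.
Proof.
move=> cg; split; first exact: meas_cont.
apply: int_on_cont => x; apply: continuousM; exact: cg.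
Qed.

Lemma L2_on_mul a b f g : L2_on a b f -> L2_on a b g ->
  int_on a b (fun x => f x * g x).
Proof.
move=> [mf iF] [mg ig].
apply: (@int_on_le _ _ _ (fun x => f x ^+ 2 + g x ^+ 2)) => //.
- exact: measurable_funM.
- exact: int_onD.
- move=> x _; rewrite normrM.
  rewrite -(real_normK (num_real (f x))) -(real_normK (num_real (g x))).
  have := sqr_ge0 (`|f x| - `|g x|).
  have := normr_ge0 (f x); have := normr_ge0 (g x); nra.
Qed.

Lemma L2_onD a b f g : L2_on a b f -> L2_on a b g ->
  L2_on a b (fun x => f x + g x).
Proof.
move=> lf lg; split; first by apply: measurable_funD; [case: lf|case: lg].
have -> : (fun x => (f x + g x) ^+ 2) =
    (fun x => f x ^+ 2 + 2 * (f x * g x) + g x ^+ 2).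
  by apply/funext => x; ring.
apply: int_onD; last by case: lg.
apply: int_onD; first by case: lf.
exact/int_onZ/L2_on_mul.
Qed.

Lemma L2_onZ a b c g : L2_on a b g -> L2_on a b (fun x => c * g x).
Proof.
move=> [mg ig]; split; first exact: measurable_funM.
under eq_fun do rewrite exprMn; exact: int_onZ.
Qed.

Lemma L2_onB a b f g : L2_on a b f -> L2_on a b g ->
  L2_on a b (fun x => f x - g x).
Proof.
move=> lf lg; have := L2_onD lf (L2_onZ (-1) lg).
by under eq_fun do rewrite mulN1r.
Qed.

Lemma L2_on_bounded a b c f g : measurable_fun `[a, b] f ->
  (forall x, a <= x <= b -> `|f x| <= c) -> L2_on a b g ->
  L2_on a b (fun x => f x * g x).
Proof.
move=> mf fc [mg ig]; split; first exact: measurable_funM.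
apply: (@int_on_le _ _ _ (fun x => c ^+ 2 * g x ^+ 2)).
- by apply: measurable_funX; exact: measurable_funM.
- exact: int_onZ.
- move=> x /fc fxc; rewrite normrX normrM exprMn !real_normK ?num_real//.
  rewrite ler_wpM2r ?sqr_ge0// -real_normK ?num_real//.
  by rewrite lerXn2r ?nnegrE// (le_trans _ fxc).
Qed.

Lemma J_pt a g : J a a g = 0.
Proof. by rewrite /J set_itv1 Rintegral_set1. Qed.

Lemma JD a b f g : int_on a b f -> int_on a b g ->
  J a b (fun x => f x + g x) = J a b f + J a b g.
Proof. by move=> *; rewrite /J RintegralD. Qed.

Lemma JB a b f g : int_on a b f -> int_on a b g ->
  J a b (fun x => f x - g x) = J a b f - J a b g.
Proof. by move=> *; rewrite /J RintegralB. Qed.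

Lemma JZ a b c g : int_on a b g -> J a b (fun x => c * g x) = c * J a b g.
Proof. by move=> *; rewrite /J RintegralZl. Qed.

Lemma J_cst a b c : a <= b -> J a b (fun=> c) = c * (b - a).
Proof.
move=> ab; transitivity (c * fine (mu `[a, b])); first exact: Rintegral_cst.
rewrite lebesgue_measure_itv/= lte_fin -EFinD.
by case: ltgtP ab => //= ->; rewrite subrr.
Qed.

Lemma J_eq a b f g : (forall x, a <= x <= b -> f x = g x) -> J a b f = J a b g.
Proof. by move=> fg; apply: eq_Rintegral => x; rewrite inE/= in_itv/=; exact: fg. Qed.

Lemma J_le a b f g : int_on a b f -> int_on a b g ->
  (forall x, a <= x <= b -> f x <= g x) -> J a b f <= J a b g.
Proof.
by move=> iF ig fg; apply: le_Rintegral => // x /=; rewrite in_itv/=; exact: fg.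
Qed.

Lemma J_ge0 a b f : (forall x, a <= x <= b -> 0 <= f x) -> 0 <= J a b f.
Proof. by move=> f0; apply: Rintegral_ge0 => x /=; rewrite in_itv/=; exact: f0. Qed.

Lemma J_norm a b f : int_on a b f -> `|J a b f| <= J a b (fun x => `|f x|).
Proof. by move=> *; exact: le_normr_Rintegral. Qed.

Lemma J_cat a b c g : a <= b -> b <= c -> int_on a c g ->
  J a c g = J a b g + J b c g.
Proof.
move=> ab bc ig; rewrite /J -(@Rintegral_itv_obnd_cbnd _ b).
  by rewrite -(@Rintegral_itvB _ g (BLeft a) (BRight c) b)// ?bnd_simp// subrKC.
by apply: integrableS ig => //; apply: subset_itv; rewrite bnd_simp.
Qed.

Lemma J_sub a x y b g : a <= x -> x <= y -> y <= b -> int_on a b g ->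
  J a y g - J a x g = J x y g.
Proof.
move=> ax xy yb ig; rewrite (J_cat ax xy) 1?addrC ?addrA ?addNr ?add0r//.
exact: int_onS ig.
Qed.

Lemma J_le_norm_cst a b c f : a <= b -> int_on a b f ->
  (forall x, a <= x <= b -> `|f x| <= c) -> `|J a b f| <= c * (b - a).
Proof.
move=> ab iF fc; rewrite (le_trans (J_norm iF))// -J_cst//.
by apply: J_le => //; [exact: int_on_norm|exact: int_on_cst].
Qed.

(** Expanding the integral of (g - c)^2 >= 0, with c the mean of g, and multiplying by b - a gives
    the inequality. *)
Lemma J_cauchy_schwarz a b g : a <= b -> L2_on a b g ->
  J a b g ^+ 2 <= (b - a) * J a b (fun x => g x ^+ 2).
Proof.
rewrite le_eqVlt => /predU1P[<-|ab] lg.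
  by rewrite J_pt subrr mul0r expr0n.
pose c := J a b g / (b - a).
have ba0 : 0 < b - a by rewrite subr_gt0.
have : 0 <= J a b (fun x => (g x - c) ^+ 2) by apply: J_ge0 => x _; exact: sqr_ge0.
rewrite (@J_eq _ _ _ (fun x => g x ^+ 2 - (2 * c) * g x + c ^+ 2)); last first.
  by move=> x _; ring.
have ig := L2_on_int lg.
have i2 : int_on a b (fun x => g x ^+ 2) by case: lg.
have icg : int_on a b (fun x => (2 * c) * g x) by exact: int_onZ.
rewrite JD; [|exact: int_onB|exact: int_on_cst].
rewrite JB// JZ// J_cst; last exact: ltW.
have -> : J a b g = c * (b - a) by rewrite /c divfK ?gt_eqF.
move=> /(mulr_ge0 (ltW ba0)) h.
rewrite -subr_ge0; by apply: le_trans h _; rewrite le_eqVlt; apply/orP; left; apply/eqP; ring.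
Qed.

Lemma J_cont a b g : a <= b -> int_on a b g ->
  {within `[a, b], continuous (fun x => J a x g)}.
Proof. by move=> ab ig; exact: parameterized_integral_continuous. Qed.

End IntegralOnSegments.

(** * Chain and product rules from estimates on increments *)

Section IncrementCriterion.
Context {R : realType}.
Implicit Types (f g h : R -> R) (a b c x y : R).
Local Notation J := integral_from_to.

(* Adding up over a partition into n equal parts, the total increment is at
   most (b - a) / n * (Q b - Q a), for every n. *)
Lemma increments_eq0 a b (D Q : R -> R) : a <= b ->
  (forall x y, a <= x -> x <= y -> y <= b ->
    `|D y - D x| <= (y - x) * (Q y - Q x)) ->
  D b = D a.
Proof.
move=> ab DQ; apply/eqP; rewrite -subr_eq0 -normr_le0 leNgt; apply/negP => d0.
set d := `|_| in d0.
pose n := Num.truncn ((b - a) * (Q b - Q a) / d).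
pose s := (b - a) / n.+1%:R.
have n0 : 0 < n.+1%:R :> R by rewrite ltr0n.
have s0 : 0 <= s by rewrite divr_ge0// ?subr_ge0// ltW.
have sn : s * n.+1%:R = b - a by rewrite divfK// gt_eqF.
have part k : (k <= n.+1)%N ->
    `|D (a + s * k%:R) - D a| <= s * (Q (a + s * k%:R) - Q a).
  elim: k => [_|k IH kn]; first by rewrite mulr0 addr0 !subrr normr0 mulr0.
  set x := a + s * k%:R in IH *; set y := a + s * k.+1%:R.
  have yx : y - x = s by rewrite /y /x -natr1; ring.
  have xy : `|D y - D x| <= s * (Q y - Q x).
    rewrite -[X in X * _]yx; apply: DQ.
    - by rewrite lerDl mulr_ge0.
    - by rewrite -subr_ge0 yx.
    - by rewrite -lerBrDl -sn ler_wpM2l// ler_nat.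
  rewrite (_ : D y - D a = (D y - D x) + (D x - D a)); last by ring.
  rewrite (le_trans (ler_normD _ _))//.
  rewrite (_ : s * (Q y - Q a) = s * (Q y - Q x) + s * (Q x - Q a)); last by ring.
  by rewrite lerD// IH// ltnW.
have := part _ (leqnn _).
rewrite sn subrKC -/d => /(ler_wpM2r (ltW n0)).
rewrite mulrAC sn leNgt => /negP; apply.
by rewrite [ltRHS]mulrC -ltr_pdivrMr// Num.Theory.truncnS_gt.
Qed.

(** By [increments_eq0] applied to [f] minus the indefinite integral of [g]. Local estimates become
    an exact formula without any pointwise differentiation, so [g] may be merely integrable. *)
Lemma integral_of_increments a b f g (Q : R -> R) : a <= b -> int_on a b g ->
  (forall x y, a <= x -> x <= y -> y <= b ->
    `|f y - f x - J x y g| <= (y - x) * (Q y - Q x)) ->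
  f b - f a = J a b g.
Proof.
move=> ab ig fQ.
have := @increments_eq0 a b (fun x => f x - J a x g) Q ab.
rewrite J_pt subr0 => H; rewrite -{}H ?subKr// => x y ax xy yb.
rewrite (_ : _ - _ = f y - f x - J x y g); first exact: fQ.
by rewrite -(J_sub ax xy yb ig); ring.
Qed.

Lemma J_le_sub a b x y g : a <= x -> x <= y -> y <= b -> int_on a b g ->
  (forall t, a <= t <= b -> 0 <= g t) -> J x y g <= J a b g.
Proof.
move=> ax xy yb ig g0.
rewrite (J_cat (le_trans ax xy) yb ig) (J_cat ax xy); last first.
  exact: int_onS ig.
have j1 : 0 <= J a x g.
  by apply: J_ge0 => t /andP[at_ tx]; apply: g0; rewrite at_; lra.
have j2 : 0 <= J y b g.
  by apply: J_ge0 => t /andP[yt tb]; apply: g0; rewrite tb andbT; lra.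
lra.
Qed.

(* The function f is only required to follow B times the increments of w up to
   second order: thus the statement covers both f = F \o w and the inverse
   situation w = F \o f. *)
Lemma chain_rule a b f w g (B : R -> R) (C : R) : a <= b -> 0 <= C ->
  L2_on a b g ->
  (forall x y, a <= x -> x <= y -> y <= b -> w y - w x = J x y g) ->
  {within `[a, b], continuous B} ->
  (forall x y, a <= x -> x <= y -> y <= b ->
    `|f y - f x - B x * (w y - w x)| <= C * (w y - w x) ^+ 2) ->
  (forall x y, a <= x -> x <= y -> y <= b ->
    `|B y - B x| <= C * `|w y - w x|) ->
  f b - f a = J a b (fun t => B t * g t).
Proof.
move=> ab C0 lg wg cB fB BB.
have ig := L2_on_int lg.
have iBg : int_on a b (fun t => B t * g t).
  by apply: L2_on_mul => //; exact: L2_on_cont.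
have ig2 : int_on a b (fun t => g t ^+ 2) by case: lg.
(* Freezing [B] at [x] costs [C * A ^+ 2] twice, once for [f] and once for the integral, where [A]
   is the integral of |g| over [x, y]. By Cauchy-Schwarz [A ^+ 2] is at most y - x times the
   integral of g^2, hence this choice of [Q]. *)
apply: (@integral_of_increments _ _ _ _
  (fun x => 2 * C * J a x (fun t => g t ^+ 2))) => // x y ax xy yb.
have igxy : int_on x y g by exact: int_onS ig.
have lgxy : L2_on x y g by exact: L2_onS lg.
have iBxy : int_on x y (fun t => B t * g t) by exact: int_onS iBg.
have nJ : `|J x y g| <= J x y (fun t => `|g t|) by exact: J_norm.
set A := J x y (fun t => `|g t|) in nJ.
have AS : A ^+ 2 <= (y - x) * J x y (fun t => g t ^+ 2).
  rewrite (@J_eq _ _ _ (fun t => g t ^+ 2) (fun t => `|g t| ^+ 2)); last first.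
    by move=> t _; rewrite real_normK ?num_real.
  apply: J_cauchy_schwarz => //; split.
    by apply: measurableT_comp => //; exact: int_on_meas igxy.
  under eq_fun do rewrite real_normK ?num_real//; exact: int_onS ig2.
have e1 : `|f y - f x - B x * (w y - w x)| <= C * A ^+ 2.
  rewrite (le_trans (fB x y ax xy yb))// ler_wpM2l//.
  have A0 : 0 <= A by exact: le_trans nJ.
  rewrite -(real_normK (num_real (w y - w x))).
  by apply: lerXn2r; rewrite ?nnegrE// wg.
have e2 : `|J x y (fun t => B t * g t) - B x * (w y - w x)| <= C * A ^+ 2.
  rewrite (wg x y)// -JZ// -JB//; last exact: int_onZ.
  have iBB : int_on x y (fun t => B t * g t - B x * g t).
    by apply: int_onB => //; exact: int_onZ.
  rewrite (le_trans (J_norm iBB))//.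
  rewrite expr2 mulrA {2}/A -JZ; last exact: int_on_norm.
  apply: J_le; [exact: int_on_norm|exact/int_onZ/int_on_norm|].
  move=> t /andP[xt ty]; rewrite -mulrBl normrM ler_wpM2r//.
  rewrite (le_trans (BB x t ax xt (le_trans ty yb)))// ler_wpM2l//.
  rewrite (wg x t)//; last exact: le_trans yb.
  rewrite (le_trans (J_norm _))//; first by apply: int_onS igxy.
  by apply: J_le_sub => //; exact: int_on_norm.
rewrite -mulrBr (J_sub ax xy yb ig2).
rewrite (_ : _ - _ = f y - f x - B x * (w y - w x) -
   (J x y (fun t => B t * g t) - B x * (w y - w x))); last by ring.
rewrite (le_trans (ler_normB _ _))//.
have := ler_wpM2l C0 AS; lra.
Qed.

(** On [x, y] the increment of P phi is exactly phi(y) (P(y) - P(x)) + P(x) (phi(y) - phi(x)).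
    Replacing these frozen values by the integrands costs at most L (y - x) times the integral of
    |g| in each term, so the increment criterion applies. *)
Lemma product_rule a b P g phi phi' (L : R) : a <= b -> L2_on a b g ->
  (forall x y, a <= x -> x <= y -> y <= b -> P y - P x = J x y g) ->
  (forall x y, a <= x -> x <= y -> y <= b -> phi y - phi x = J x y phi') ->
  {within `[a, b], continuous P} -> {within `[a, b], continuous phi} ->
  {within `[a, b], continuous phi'} ->
  (forall x, a <= x <= b -> `|phi' x| <= L) ->
  P b * phi b - P a * phi a =
  J a b (fun t => P t * phi' t) + J a b (fun t => g t * phi t).
Proof.
move=> ab lg Pg ph cP cphi cphi' phiL.
have ig := L2_on_int lg.
have i1 : int_on a b (fun t => P t * phi' t).
  by apply: L2_on_mul; exact: L2_on_cont.
have i2 : int_on a b (fun t => g t * phi t).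
  by apply: L2_on_mul => //; exact: L2_on_cont.
rewrite -JD//.
apply: (@integral_of_increments _ _ (fun t => P t * phi t) _
  (fun x => 2 * L * J a x (fun t => `|g t|))) => //; first exact: int_onD.
move=> x y ax xy yb.
have sub (h : R -> R) : int_on a b h -> int_on x y h by exact: int_onS.
have iphi' : int_on x y phi' by exact/sub/int_on_cont.
have igxy : int_on x y g by exact: sub.
have L0 : 0 <= L by apply: le_trans (phiL a _); rewrite ?lexx.
rewrite -mulrBr (J_sub ax xy yb); last exact: int_on_norm.
set A := J x y (fun t => `|g t|).
have PA t : x <= t -> t <= y -> `|P t - P x| <= A.
  move=> xt ty; rewrite Pg//; last exact: le_trans yb.
  rewrite (le_trans (J_norm _))//; first by apply: int_onS igxy.
  by apply: J_le_sub => //; exact: int_on_norm.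
have phA t : x <= t -> t <= y -> `|phi y - phi t| <= L * (y - x).
  move=> xt ty; rewrite ph//; last exact: le_trans xt.
  have xty : L * (y - t) <= L * (y - x) by rewrite ler_wpM2l// lerB.
  apply: le_trans xty; apply: J_le_norm_cst => //.
    by apply: int_onS iphi'.
  by move=> s /andP[ts sy]; apply: phiL; apply/andP; split; lra.
have e1 : `|J x y (fun t => g t * phi t) - phi y * (P y - P x)| <= L * (y - x) * A.
  rewrite Pg// -JZ// -JB//; last 2 first.
  - exact: sub.
  - exact: int_onZ.
  have i3 : int_on x y (fun t => g t * phi t - phi y * g t).
    by apply: int_onB; [exact: sub|exact: int_onZ].
  rewrite (le_trans (J_norm i3))// -JZ; last exact: int_on_norm.
  apply: J_le; [exact: int_on_norm|exact/int_onZ/int_on_norm|].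
  move=> t /andP[xt ty]; rewrite mulrC -mulrBl normrM ler_wpM2r// distrC.
  exact: phA.
have e2 : `|J x y (fun t => P t * phi' t) - P x * (phi y - phi x)| <=
    A * L * (y - x).
  rewrite ph// -JZ// -JB//; last 2 first.
  - exact: sub.
  - exact: int_onZ.
  apply: J_le_norm_cst => //; first by apply: int_onB; [exact: sub|exact: int_onZ].
  move=> t /andP[xt ty]; rewrite -mulrBl normrM ler_pM//; first exact: PA.
  by apply: phiL; apply/andP; split; lra.
rewrite JD; [|exact: sub..].
set J1 := J x y _ in e2 *; set J2 := J x y _ in e1 *.
rewrite (_ : _ - _ = - ((J2 - phi y * (P y - P x)) + (J1 - P x * (phi y - phi x)))); last by ring.
by rewrite normrN (le_trans (ler_normD _ _))//; lra.
Qed.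

End IncrementCriterion.

(** * A smooth step function built from exp(-1/x) *)

Section SmoothStep.
Context {R : realType}.
Implicit Types (f g h : R -> R) (a b c x y : R).

(** The power of 1/x is carried along so that the family is closed under differentiation up to
    linear combinations; [k = 0] is the usual flat function exp(-1/x). *)
Definition flat_exp (k : nat) x : R :=
  if 0 < x then x^-1 ^+ k * expR (- x^-1) else 0.

Lemma flat_exp_ge0 k x : 0 <= flat_exp k x.
Proof.
rewrite /flat_exp; case: ifPn => // x0.
by rewrite mulr_ge0 ?expR_ge0// exprn_ge0// invr_ge0 ltW.
Qed.

Lemma flat_exp_le0 k x : x <= 0 -> flat_exp k x = 0.
Proof. by move=> x0; rewrite /flat_exp ltNge x0. Qed.

Lemma flat_exp0_gt0 x : 0 < x -> 0 < flat_exp 0 x.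
Proof. by move=> x0; rewrite /flat_exp x0 expr0 mul1r expR_gt0. Qed.

(** For x > 0, exp(1/x) exceeds the term of degree k + 2 of its series. A quadratic bound is what
    gives derivative 0 at the origin. *)
Lemma flat_exp_le_sqr k x : `|flat_exp k x| <= (k.+2)`!%:R * x ^+ 2.
Proof.
rewrite ger0_norm ?flat_exp_ge0// /flat_exp; case: ifPn => [x0|_]; last first.
  by rewrite mulr_ge0// sqr_ge0.
have F0 : (0 : R) < (k.+2)`!%:R by rewrite ltr0n fact_gt0.
have := @expR_ge1Dxn R x^-1 k.+1; rewrite invr_ge0 => /(_ (ltW x0)) h.
have {h} : x^-1 ^+ k.+2 / (k.+2)`!%:R <= expR x^-1.
  by apply: le_trans h; rewrite lerDr.
rewrite ler_pdivrMr// => h.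
rewrite expRN exprVn -invfM -div1r ler_pdivrMr ?mulr_gt0 ?exprn_gt0 ?expR_gt0//.
have := ler_wpM2l (exprn_ge0 k.+2 (ltW x0)) h.
rewrite exprVn divff ?expf_neq0 ?gt_eqF// => /le_trans; apply.
rewrite le_eqVlt; apply/orP; left; apply/eqP.
by rewrite !exprS; ring.
Qed.

Lemma is_derive0_sqr f c : (forall x, `|f x| <= c * x ^+ 2) ->
  is_derive (0 : R) (1 : R) f 0.
Proof.
move=> fc.
have f0 : f 0 = 0.
  by apply/eqP; rewrite -normr_le0 (le_trans (fc 0))// expr0n mulr0.
have c0 : 0 <= c by apply: le_trans (normr_ge0 _) (le_trans (fc 1) _); rewrite expr1n mulr1.
have fd : h^-1 *: (f (h *: 1 + 0) - f 0) @[h --> 0^'] --> (0 : R).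
  apply/cvgr0Pnorm_le => e e0.
  have d0 : 0 < e / (c + 1) by rewrite divr_gt0// ltr_wpDl.
  near=> h; rewrite f0 subr0 addr0.
  have h0 : h != 0 by near: h; exact: nbhs_dnbhs_neq.
  rewrite normrZ normfV /= [h *: 1]mulr1 ler_pdivrMl ?normr_gt0//.
  rewrite (le_trans (fc h))// -real_normK ?num_real// expr2 mulrA mulrC.
  rewrite ler_wpM2l//.
  have : `|h| <= e / (c + 1).
    near: h; apply: dnbhs0_le => //.
  rewrite ler_pdivlMr ?ltr_wpDl//; apply: le_trans.
  by rewrite mulrC ler_wpM2l// lerDl.
by constructor; [apply/cvg_ex; exists 0|exact/cvg_lim].
Unshelve. all: by end_near. Qed.

Lemma is_derive_flat_exp k x :
  is_derive x (1 : R) (flat_exp k) (flat_exp k.+2 x - k%:R * flat_exp k.+1 x).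
Proof.
have [x0|x0|->] := ltgtP x 0; last first.
- rewrite !flat_exp_le0// mulr0 subrr.
  exact: is_derive0_sqr (flat_exp_le_sqr k).
- have : is_derive x 1 (fun y : R => y^-1 ^+ k * expR (- y^-1))
      (flat_exp k.+2 x - k%:R * flat_exp k.+1 x).
    have xn : id x != 0 by rewrite gt_eqF.
    have dV := is_deriveV xn (is_derive_id x 1).
    have dX := is_deriveX k dV.
    have dN := is_deriveN dV.
    have dE := @is_derive1_comp R expR (fun y => - y^-1) x _ _ (is_derive_expR _) dN.
    have := is_deriveM dX dE.
    have -> : ([eta GRing.inv] ^+ k * (expR \o (fun y : R => - y^-1)) : R -> R) =
        (fun y : R => y^-1 ^+ k * expR (- y^-1)).
      by apply/funext => y; rewrite !fctE.
    move=> /is_derive_eq; apply; rewrite /flat_exp x0 /= /GRing.scale/=.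
    case: k {dX dE} => [|k] /=.
      by rewrite !fctE; field; rewrite gt_eqF.
    by rewrite !fctE !exprS; field; rewrite gt_eqF.
  apply: near_eq_is_derive; near=> y.
  rewrite /flat_exp ifT//; near: y; exact: lt_nbhsr.
- rewrite !flat_exp_le0 ?ltW// mulr0 subrr.
  apply: near_eq_is_derive (is_derive_cst (0 : R) x 1); near=> y.
  rewrite flat_exp_le0// ltW//; near: y; exact: lt_nbhsl.
Unshelve. all: by end_near. Qed.

(* The derivative of an elementary function is elementary, so that elementary
   functions are smooth. *)
Inductive elementary : (R -> R) -> Prop :=
| elem_flat k a b : elementary (fun x => flat_exp k (a * x + b))
| elem_cst c : elementary (fun=> c)
| elem_add f g : elementary f -> elementary g -> elementary (fun x => f x + g x)
| elem_mul f g : elementary f -> elementary g -> elementary (fun x => f x * g x)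
| elem_inv f : elementary f -> (forall x, f x != 0) -> elementary (fun x => (f x)^-1).

Lemma elementary_derive f : elementary f ->
  exists2 f', elementary f' & forall x, is_derive x (1 : R) f (f' x).
Proof.
elim=> {f}.
- move=> k a b.
  exists (fun x => a * (flat_exp k.+2 (a * x + b) +
                        - k%:R * flat_exp k.+1 (a * x + b))).
    do ![exact: elem_flat | exact: elem_cst | apply: elem_mul | apply: elem_add].
  move=> x.
  have da : is_derive x (1 : R) (fun x => a * x + b) a.
    have := is_deriveD (is_deriveZ a (is_derive_id x (1 : R))) (is_derive_cst b x 1).
    by move=> /is_derive_eq; apply; rewrite addr0 /GRing.scale/= mulr1.
  have := @is_derive1_comp R (flat_exp k) (fun x => a * x + b) x _ _ (is_derive_flat_exp k _) da.
  by move=> /is_derive_eq; apply; rewrite mulrC mulNr.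
- move=> c; exists (fun=> 0); first exact: elem_cst.
  by move=> x; exact: is_derive_cst.
- move=> f g ef [f' ef' df] eg [g' eg' dg].
  exists (fun x => f' x + g' x); first exact: elem_add.
  by move=> x; exact: is_deriveD.
- move=> f g ef [f' ef' df] eg [g' eg' dg].
  exists (fun x => f x * g' x + g x * f' x).
    by apply: elem_add; exact: elem_mul.
  by move=> x; exact: is_deriveM.
- move=> f ef [f' ef' df] f0.
  exists (fun x => -1 * ((f x)^-1 * (f x)^-1) * f' x).
    do ![exact: elem_inv | exact: elem_cst | apply: elem_mul | exact: ef'].
  move=> x; apply: is_derive_eq (is_deriveV (f0 x) (df x)) _.
  by rewrite /GRing.scale/= mulN1r expr2 invfM.
Qed.

Lemma elementary_smooth f : elementary f -> smooth f.
Proof.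
move=> ef n.
suff en : elementary (derive1n n f).
  by move=> x; have [f' _ /(_ x)[]] := elementary_derive en.
elim: n => // n IH; rewrite derive1nS.
have [f' ef' df] := elementary_derive IH.
suff -> : (f^`(n)^`())%classic = f' by [].
apply/funext => x; rewrite derive1E.
by have [_ ->] := df x.
Qed.

(** The standard transition function, 0 on the left of 0 and 1 on the right of 1. The denominator
    never vanishes because x and 1 - x are not both nonpositive. *)
Definition smooth_step x : R :=
  flat_exp 0 x * (flat_exp 0 x + flat_exp 0 (1 - x))^-1.

(** The quotient rule, simplified so that nonnegativity and vanishing outside (0, 1) can be read
    off. *)
Definition smooth_step' x : R :=
  (flat_exp 2 x * flat_exp 0 (1 - x) + flat_exp 0 x * flat_exp 2 (1 - x)) *
  (flat_exp 0 x + flat_exp 0 (1 - x))^-1 ^+ 2.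

Lemma smooth_step_den x : 0 < flat_exp 0 x + flat_exp 0 (1 - x).
Proof.
have [x0|x0] := ltP 0 x.
  by rewrite ltr_pwDl ?flat_exp_ge0// flat_exp0_gt0.
by rewrite ltr_wpDl ?flat_exp_ge0// flat_exp0_gt0// subr_gt0 (le_lt_trans x0).
Qed.

Lemma smooth_step_le0 x : x <= 0 -> smooth_step x = 0.
Proof. by move=> x0; rewrite /smooth_step flat_exp_le0// mul0r. Qed.

Lemma smooth_step_ge1 x : 1 <= x -> smooth_step x = 1.
Proof.
move=> x1; have := smooth_step_den x; rewrite /smooth_step.
by rewrite (@flat_exp_le0 _ (1 - x)) ?subr_le0// addr0 => ?; rewrite divff ?gt_eqF.
Qed.

Lemma smooth_step'_ge0 x : 0 <= smooth_step' x.
Proof.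
by rewrite mulr_ge0 ?sqr_ge0// addr_ge0// mulr_ge0// flat_exp_ge0.
Qed.

Lemma smooth_step'_out x : x <= 0 \/ 1 <= x -> smooth_step' x = 0.
Proof.
rewrite /smooth_step'; case=> x0; first by rewrite !(flat_exp_le0 _ x0) !mul0r add0r mul0r.
by rewrite !(@flat_exp_le0 _ (1 - x)) ?subr_le0// !mulr0 add0r mul0r.
Qed.

Lemma elementary_step a b : elementary (fun x => smooth_step (a * x + b)).
Proof.
rewrite /smooth_step.
have e1 : (fun x => flat_exp 0 (1 - (a * x + b))) =
          (fun x => flat_exp 0 (- a * x + (1 - b))).
  by apply/funext => x; congr flat_exp; ring.
have e2 : elementary (fun x => flat_exp 0 (a * x + b) + flat_exp 0 (1 - (a * x + b))).
  by apply: elem_add; [|rewrite e1]; exact: elem_flat.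
apply: elem_mul; first exact: elem_flat.
by apply: elem_inv => // x; rewrite gt_eqF// smooth_step_den.
Qed.

Lemma is_derive_smooth_step x : is_derive x (1 : R) smooth_step (smooth_step' x).
Proof.
have d1 := is_derive_flat_exp 0 x.
have db : is_derive x (1 : R) (fun x => 1 - x) (-1).
  have := is_deriveB (is_derive_cst (1 : R) x 1) (is_derive_id x (1 : R)).
  by move=> /is_derive_eq; apply; rewrite sub0r.
have d2 := @is_derive1_comp R (flat_exp 0) (fun x => 1 - x) x _ _ (is_derive_flat_exp 0 _) db.
have d0 : (flat_exp 0 + (flat_exp 0 \o (fun x => 1 - x))) x != 0.
  by rewrite gt_eqF//; exact: smooth_step_den.
have := is_deriveM d1 (is_deriveV d0 (is_deriveD d1 d2)).
move=> /is_derive_eq; apply; rewrite /GRing.scale/= /smooth_step'.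
have := smooth_step_den x.
rewrite !mul0r !subr0 (_ : (flat_exp 0 + (flat_exp 0 \o (fun x => 1 - x))) x =
  flat_exp 0 x + flat_exp 0 (1 - x))//.
move: (flat_exp 0 x) (flat_exp 2 x) (flat_exp 0 (1 - x)) (flat_exp 2 (1 - x)).
move=> A B A1 B1 AA; field; exact: lt0r_neq0.
Qed.

End SmoothStep.

(** * The du Bois-Reymond lemma *)

Section FundamentalLemma.
Context {R : realType}.
Implicit Types (f g h D : R -> R) (a b c x y e : R).
Local Notation J := integral_from_to.

Lemma derivable_continuous f f' : (forall x, is_derive x (1 : R) f (f' x)) ->
  continuous f.
Proof.
by move=> df x; apply: differentiable_continuous; apply/derivable1_diffP; case: (df x).
Qed.

Lemma within_cont a b f : continuous f -> {within `[a, b], continuous f}.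
Proof. exact: continuous_subspaceT. Qed.

Lemma J_derive a b f f' : a <= b ->
  (forall x, is_derive x (1 : R) f (f' x)) -> continuous f' ->
  J a b f' = f b - f a.
Proof.
rewrite le_eqVlt => /predU1P[<-|ab] df cf'; first by rewrite J_pt subrr.
have cf := derivable_continuous df.
rewrite /J /Rintegral (@continuous_FTC2 _ f' f)//.
- exact: within_cont.
- split.
  + by move=> x _; case: (df x).
  + exact/cvg_at_right_filter/cf.
  + exact/cvg_at_left_filter/cf.
- by move=> x _; rewrite derive1E; case: (df x).
Qed.

Lemma elementary_derive_continuous f f' : elementary f ->
  (forall x, is_derive x (1 : R) f (f' x)) -> continuous f'.
Proof.
move=> /elementary_derive[g eg dg] df.
have -> : f' = g.
  by apply/funext => x; have [_ <-] := df x; have [_ <-] := dg x.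
have [g' _ dg'] := elementary_derive eg; exact: derivable_continuous dg'.
Qed.

(** For e > 0 the transition takes place on [c, c + e]; the derivative [bump_at] is a nonnegative
    mollifier supported there, of mass 1. *)
Definition step_at c e x : R := smooth_step (e^-1 * x - e^-1 * c).
Definition bump_at c e x : R := e^-1 * smooth_step' (e^-1 * x - e^-1 * c).

Lemma is_derive_step_at c e x : is_derive x (1 : R) (step_at c e) (bump_at c e x).
Proof.
have da : is_derive x (1 : R) (fun x => e^-1 * x - e^-1 * c) e^-1.
  have := is_deriveB (is_deriveZ e^-1 (is_derive_id x (1 : R)))
    (is_derive_cst (e^-1 * c) x 1).
  by move=> /is_derive_eq; apply; rewrite subr0 /GRing.scale/= mulr1.
have := @is_derive1_comp R smooth_step (fun x => e^-1 * x - e^-1 * c) x _ _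
  (is_derive_smooth_step _) da.
by move=> /is_derive_eq; apply; rewrite mulrC.
Qed.

Lemma continuous_bump_at c e : continuous (bump_at c e).
Proof.
exact: elementary_derive_continuous (elementary_step _ _) (is_derive_step_at c e).
Qed.

Lemma bump_at_ge0 c e x : 0 < e -> 0 <= bump_at c e x.
Proof. by move=> e0; rewrite mulr_ge0 ?smooth_step'_ge0// invr_ge0 ltW. Qed.

Lemma step_at_le c e x : 0 < e -> x <= c -> step_at c e x = 0.
Proof.
move=> e0 xc; rewrite /step_at smooth_step_le0// -mulrBr.
by rewrite pmulr_rle0 ?invr_gt0// subr_le0.
Qed.

Lemma step_at_ge c e x : 0 < e -> c + e <= x -> step_at c e x = 1.
Proof.
move=> e0 xc; rewrite /step_at smooth_step_ge1// -mulrBr.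
by rewrite ler_pdivlMl// mulr1 lerBrDl.
Qed.

Lemma bump_at_out c e x : 0 < e -> x <= c \/ c + e <= x -> bump_at c e x = 0.
Proof.
move=> e0 xc; rewrite /bump_at smooth_step'_out ?mulr0// -mulrBr.
case: xc => xc; [left|right].
  by rewrite pmulr_rle0 ?invr_gt0// subr_le0.
by rewrite ler_pdivlMl// mulr1 lerBrDl.
Qed.

(** A single step is not compactly supported, but two steps cancel to the left of both transitions,
    where both are 0, and to the right, where both are 1. *)
Lemma test_function_step a b e : 0 < e -> 0 < a -> 0 < b ->
  a + e < 1 -> b + e < 1 -> test_function (fun x => step_at a e x - step_at b e x).
Proof.
move=> e0 a0 b0 a1 b1.
pose l := Num.min a b; pose r := Num.max a b + e.
have supp : closure [set x | step_at a e x - step_at b e x != 0] `<=` `[l, r].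
  rewrite [X in _ `<=` X](closure_id _).1; last exact: itv_closed.
  apply: closure_subset => x /=; apply: contraNP => /negP.
  rewrite in_itv/= negb_and -!ltNge => /orP[xl|rx].
    by move: xl; rewrite lt_min => /andP[xa xb]; rewrite !step_at_le ?subrr ?ltW.
  have [ra rb] : a + e <= r /\ b + e <= r.
    by rewrite /r !lerD2r !le_max !lexx orbT.
  by rewrite !step_at_ge ?subrr//; apply: le_trans (ltW rx).
split.
- apply: elementary_smooth.
  have -> : (fun x => step_at a e x - step_at b e x) =
      (fun x => smooth_step (e^-1 * x + - (e^-1 * a)) +
                -1 * smooth_step (e^-1 * x + - (e^-1 * b))).
    by apply/funext => x; rewrite mulN1r.
  do ![exact: elementary_step | exact: elem_cst | apply: elem_mul | apply: elem_add].
- by apply: subclosed_compact supp; [exact: closed_closure|exact: segment_compact].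
- apply: (subset_trans supp); apply: subset_itv; rewrite bnd_simp.
    by rewrite lt_min a0.
  by rewrite /r; case: (leP a b).
Qed.

Lemma J_bump a e : 0 < e -> 0 <= a -> a + e <= 1 -> J 0 1 (bump_at a e) = 1.
Proof.
move=> e0 a0 ae; rewrite (J_derive _ (is_derive_step_at a e))//; last first.
  exact: continuous_bump_at.
by rewrite step_at_ge// step_at_le// subr0.
Qed.

(* Testing against step_at a e - step_at b e compares averages of D over small
   intervals to the right of a and of b. *)
Lemma const_of_test D : {within `[0, 1], continuous D} ->
  (forall phi, test_function phi -> J 0 1 (fun x => D x * derive1 phi x) = 0) ->
  forall x, 0 <= x <= 1 -> D x = D 0.
Proof.
move=> cD tD.
have [cDi cD0 cD1] : [/\ {in `]0, 1[, continuous D}, D x @[x --> 0^'+] --> D 0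
     & D x @[x --> 1^'-] --> D 1].
  exact/continuous_within_itvP.
have le_D a b : 0 < a < 1 -> 0 < b < 1 -> D b <= D a.
  (* If D a < D b, then [m1] and [m2] cut the gap into thirds. Near [a] the values stay below [m1],
     near [b] above [m2], so the two averages cannot agree. Exchanging [a] and [b] later gives
     equality. *)
  move=> /andP[a0 a1] /andP[b0 b1]; rewrite leNgt; apply/negP => Dab.
  pose m1 := (D a + D a + D b) / 3; pose m2 := (D a + D b + D b) / 3.
  have m12 : m1 < m2 by rewrite /m1 /m2; lra.
  have Da : D a < m1 by rewrite /m1; lra.
  have Db : m2 < D b by rewrite /m2; lra.
  have [r1 /= r10 Dr1] : exists2 r : R, 0 < r & forall x, `|a - x| < r -> D x < m1.
    have : \forall x \near a, D x < m1.
      have h : D x @[x --> a] --> D a by apply: cDi; rewrite in_itv/= a0.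
      exact: (cvgr_lt _ h).
    by move=> /nbhs_ballP[r /= r0 ar]; exists r.
  have [r2 /= r20 Dr2] : exists2 r : R, 0 < r & forall x, `|b - x| < r -> m2 < D x.
    have : \forall x \near b, m2 < D x.
      have h : D x @[x --> b] --> D b by apply: cDi; rewrite in_itv/= b0.
      exact: (cvgr_gt _ h).
    by move=> /nbhs_ballP[r /= r0 ar]; exists r.
  have [e [e0 [ae be] [er1 er2]]] : exists e : R, [/\ 0 < e, a + e < 1 /\ b + e < 1 &
     e < r1 /\ e < r2].
    exists (Num.min (Num.min (1 - a) (1 - b)) (Num.min r1 r2) / 2).
    have [? [? [? [? ?]]]] : let m := Num.min (Num.min (1 - a) (1 - b)) (Num.min r1 r2) in
       0 < m /\ m <= 1 - a /\ m <= 1 - b /\ m <= r1 /\ m <= r2.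
      by rewrite /= !lt_min !ge_min r10 r20 !subr_gt0 a1 b1 !lexx !orbT.
    by split; [|split|split]; lra.
  have Dae x : a <= x <= a + e -> D x <= m1.
    by move=> /andP[ax xae]; apply/ltW/Dr1; rewrite ler0_norm; lra.
  have Dbe x : b <= x <= b + e -> m2 <= D x.
    by move=> /andP[ax xae]; apply/ltW/Dr2; rewrite ler0_norm; lra.
  have := tD _ (test_function_step e0 a0 b0 ae be).
  have -> : derive1 (fun x => step_at a e x - step_at b e x) =
      (fun x => bump_at a e x - bump_at b e x).
    apply/funext => x; rewrite derive1E.
    by have [_ ->] := is_deriveB (is_derive_step_at a e x) (is_derive_step_at b e x).
  have cbump c : {within `[0, 1], continuous (bump_at c e)}.
    exact/within_cont/continuous_bump_at.
  have iD c : int_on 0 1 (fun x => D x * bump_at c e x).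
    by apply: L2_on_mul; exact: L2_on_cont.
  have ib c : int_on 0 1 (bump_at c e) by exact: int_on_cont.
  rewrite (@J_eq _ _ _ _ (fun x => D x * bump_at a e x - D x * bump_at b e x)); last first.
    by move=> x _; rewrite mulrBr.
  rewrite JB//.
  have h1 : J 0 1 (fun x => D x * bump_at a e x) <= m1.
    rewrite -[leRHS]mulr1 -[X in _ * X](J_bump e0 (ltW a0) (ltW ae)) -JZ//.
    apply: J_le => //; first exact: int_onZ.
    move=> x _; have [xa|xa] := leP x a; first by rewrite bump_at_out ?mulr0//; left.
    have [xae|xae] := leP (a + e) x; first by rewrite bump_at_out ?mulr0//; right.
    by rewrite ler_wpM2r ?bump_at_ge0// Dae// !ltW.
  have h2 : m2 <= J 0 1 (fun x => D x * bump_at b e x).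
    rewrite -[leLHS]mulr1 -[X in _ * X](J_bump e0 (ltW b0) (ltW be)) -JZ//.
    apply: J_le => //; first exact: int_onZ.
    move=> x _; have [xa|xa] := leP x b; first by rewrite bump_at_out ?mulr0//; left.
    have [xae|xae] := leP (b + e) x; first by rewrite bump_at_out ?mulr0//; right.
    by rewrite ler_wpM2r ?bump_at_ge0// Dbe// !ltW.
  by move=> /subr0_eq e1; move: (le_lt_trans h1 m12); rewrite e1 ltNge h2.
have D_in a b : 0 < a < 1 -> 0 < b < 1 -> D a = D b.
  by move=> a01 b01; apply/eqP; rewrite eq_le !le_D.
have h01 : 0 < (2^-1 : R) < 1 by apply/andP; split; lra.
have D0 : D 0 = D 2^-1.
  apply: (cvg_unique _ cD0) => //; apply: cvg_near_cst; near=> x.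
  by apply: D_in => //; apply/andP; split; near: x;
    [exact: nbhs_right_gt|exact: nbhs_right_lt].
have D1 : D 1 = D 2^-1.
  apply: (cvg_unique _ cD1) => //; apply: cvg_near_cst; near=> x.
  by apply: D_in => //; apply/andP; split; near: x;
    [exact: nbhs_left_gt|exact: nbhs_left_lt].
move=> x /andP[]; rewrite D0 !le_eqVlt => /predU1P[<- _ //|x0].
move=> /predU1P[->//|x1]; apply: D_in => //; exact/andP.
Unshelve. all: by end_near. Qed.

End FundamentalLemma.

(** * Weak derivatives and primitives *)

Section WeakDerivatives.
Context {R : realType}.
Implicit Types (f g h P phi : R -> R) (a b c x y : R).
Local Notation mu := (@lebesgue_measure R).
Local Notation J := integral_from_to.

Lemma int_on_oo a b f :
  mu.-integrable `]a, b[ (EFin \o f) <-> int_on a b f.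
Proof.
split=> [/integrableP[mf fy]|]; last first.
  by apply: integrableS => //; apply: subset_itv_oo_cc.
have mf' : measurable_fun `]a, b[ f by exact/measurable_EFinP.
apply/integrableP; split.
  by apply/measurable_EFinP; exact: measurable_fun_itv_cc mf'.
rewrite integral_itv_bndoo//; apply: measurableT_comp => //.
Qed.

Lemma Rintegral_oo a b f : int_on a b f -> \int[mu]_(x in `]a, b[) f x = J a b f.
Proof.
move=> fi; rewrite /J /Rintegral; congr fine; apply/esym/integral_itv_bndoo.
apply/measurable_EFinP; apply: measurable_funS (int_on_meas fi) => //.
exact: subset_itv_oo_cc.
Qed.

(** The zero extension from the open interval and the restriction to the closed one differ only on a
    null set, and the L^2 norm of the extension is the integral of the square. *)
Lemma L2E f : L2 f <-> L2_on 0 1 f.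
Proof.
pose D : set R := `]0, 1[%classic.
have mD : measurable (D : set (measurableTypeR R)) by exact: measurable_itv.
have sqrE : (fun x => (f \_ D) x ^+ 2) = (fun x => f x ^+ 2) \_ D.
  by apply/funext => x; rewrite !patchE; case: ifPn => // _; rewrite expr0n.
split.
- move=> Lf.
  have mf : measurable_fun D f.
    apply/(measurable_restrictT f mD).
    move: Lf; rewrite /L2 inE => /andP[+ _]; rewrite inE; exact.
  split; first exact: measurable_fun_itv_cc mf.
  apply/int_on_oo; have := Lfun2_integrable_sqr Lf.
  by rewrite sqrE -restrict_EFin => /(integrable_restrict mu mD measurableT); rewrite setTI.
- move=> [mf /int_on_oo f2].
  have mfD : measurable_fun [set: R] (f \_ D).
    apply/(measurable_restrictT f mD); apply: measurable_funS mf => //.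
    exact: subset_itv_oo_cc.
  rewrite /L2 inE; apply/andP; split; rewrite inE//=.
  rewrite /finite_norm unlock poweR_lty//.
  have : (\int[mu]_x ((fun x => f x ^+ 2) \_ D x)%:E < +oo)%E.
    have : mu.-integrable [set: R] ((EFin \o (fun x => f x ^+ 2)) \_ D).
      by apply/(integrable_restrict mu mD measurableT); rewrite setTI.
    move=> /integrableP[_]; apply: le_lt_trans.
    rewrite restrict_EFin; apply: ge0_le_integral => //.
    + by move=> x _; rewrite lee_fin -sqrE sqr_ge0.
    + apply/measurable_EFinP; rewrite -sqrE; exact: measurable_funX.
    + by apply: measurableT_comp => //; apply/measurable_EFinP; rewrite -sqrE; exact: measurable_funX.
    + by move=> x _; rewrite /= lee_fin ler_norm.
  apply: le_lt_trans; rewrite -sqrE le_eqVlt; apply/orP; left; apply/eqP.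
  apply: eq_integral => x _ /=.
  by rewrite -[in RHS](real_normK (num_real _)) powR_mulrn.
Qed.

Lemma test_function_out phi x : test_function phi -> x <= 0 \/ 1 <= x -> phi x = 0.
Proof.
move=> [_ _ supp] x01; apply/eqP/negPn/negP => phx.
have := supp _ (@subset_closure _ [set x | phi x != 0] _ phx).
by rewrite /= in_itv/= => /andP[x0 x1]; case: x01; rewrite leNgt ?x0 ?x1.
Qed.

Lemma test_function_cont phi : test_function phi ->
  [/\ (forall x, is_derive x (1 : R) phi (derive1 phi x)), continuous phi &
      continuous (derive1 phi)].
Proof.
move=> [sphi _ _].
have d0 x : is_derive x (1 : R) phi (derive1 phi x).
  by constructor; [exact: (sphi 0%N)|rewrite derive1E].
split => //; first exact: derivable_continuous d0.
have d1 x : is_derive x (1 : R) (derive1 phi) (derive1 (derive1 phi) x).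
  by constructor; [exact: (sphi 1%N)|rewrite derive1E].
exact: derivable_continuous d1.
Qed.

Lemma within_bounded a b f : a <= b -> {within `[a, b], continuous f} ->
  exists2 M, 0 <= M & forall x, a <= x <= b -> `|f x| <= M.
Proof.
move=> ab cf.
have cn : {within `[a, b], continuous (fun x => `|f x|)}.
  by move=> x; apply: continuous_comp; [exact: cf|exact: norm_continuous].
have [c _ fc] := EVT_max ab cn.
by exists `|f c|.
Qed.

Lemma is_weak_derivativeE f g : L2_on 0 1 f -> L2_on 0 1 g ->
  is_weak_derivative f g <-> (forall phi, test_function phi ->
    J 0 1 (fun x => f x * derive1 phi x) = - J 0 1 (fun x => g x * phi x)).
Proof.
move=> lf lg.
have E phi : test_function phi ->
    \int[mu]_(x in `]0, 1[) (f x * derive1 phi x) =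
      J 0 1 (fun x => f x * derive1 phi x) /\
    \int[mu]_(x in `]0, 1[) (g x * phi x) = J 0 1 (fun x => g x * phi x).
  move=> /test_function_cont[_ cphi cphi']; split; apply: Rintegral_oo;
    apply: L2_on_mul => //; exact/L2_on_cont/within_cont.
by split=> fg phi tphi; have := fg _ tphi; have [-> ->] := E _ tphi.
Qed.

(** With [g] integrable this is absolute continuity of [P] with derivative [g]. The form by
    increments is the one that the chain and product rules consume. *)
Definition primitive_on01 P g :=
  forall x y, 0 <= x -> x <= y -> y <= 1 -> P y - P x = J x y g.

Lemma primitive_continuous P g : int_on 0 1 g -> primitive_on01 P g ->
  {within `[0, 1], continuous P}.
Proof.
move=> ig Pg.
have : {within `[0, 1], continuous (fun x => P 0 + J 0 x g)}.
  by move=> x; apply: cvgD; [exact: cvg_cst|exact: (J_cont ler01 ig)].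
apply: subspace_eq_continuous => x; rewrite inE/= in_itv/= => /andP[x0 x1].
by rewrite /from_subspace -Pg// subrKC.
Qed.

Lemma J_primitive g : int_on 0 1 g -> primitive_on01 (fun x => J 0 x g) g.
Proof. by move=> ig x y x0 xy y1; rewrite (J_sub x0 xy y1 ig). Qed.

(** Integration by parts, with boundary terms killed by the support of the test function. *)
Lemma primitive_weak_derivative P g : L2_on 0 1 g -> primitive_on01 P g ->
  is_weak_derivative P g.
Proof.
move=> lg Pg.
have cP := primitive_continuous (L2_on_int lg) Pg.
apply/is_weak_derivativeE => //; first exact: L2_on_cont.
move=> phi tphi; have [dphi cphi cphi'] := test_function_cont tphi.
have cphi'w := @within_cont R 0 1 _ cphi'.
have [L _ phiL] := within_bounded ler01 cphi'w.
have := @product_rule R 0 1 P g phi (derive1 phi) L ler01 lg Pg _ cP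
  (@within_cont _ 0 1 _ cphi) cphi'w phiL.
have phi1 : phi 1 = 0 by apply: (test_function_out tphi); right; exact: lexx.
have phi0 : phi 0 = 0 by apply: (test_function_out tphi); left; exact: lexx.
rewrite phi0 phi1 !mulr0 subrr => /(_ _)/esym/eqP; rewrite addr_eq0 => h; apply/eqP/h.
by move=> x y _ xy _; rewrite (J_derive xy dphi).
Qed.

(** The indefinite integral of [g] has the same weak derivative as [f]; their difference is
    continuous and orthogonal to all derivatives of test functions, hence constant. *)
Lemma weak_derivative_primitive f g : {within `[0, 1], continuous f} ->
  L2_on 0 1 g -> is_weak_derivative f g -> primitive_on01 f g.
Proof.
move=> cf lg fg.
have ig := L2_on_int lg.
pose P x := J 0 x g.
have Pg : primitive_on01 P g by exact: J_primitive.
have cP := primitive_continuous ig Pg.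
have lf := L2_on_cont cf; have lP := L2_on_cont cP.
have wP := primitive_weak_derivative lg Pg.
have cD : {within `[0, 1], continuous (fun x => f x - P x)}.
  by move=> x; apply: continuousB; [exact: cf|exact: cP].
have D0 := const_of_test cD.
have {}D0 : forall x, 0 <= x <= 1 -> f x - P x = f 0 - P 0.
  apply: D0 => phi tphi.
  have [_ _ /(@within_cont _ 0 1)/L2_on_cont lphi'] := test_function_cont tphi.
  have := (is_weak_derivativeE lf lg).1 fg _ tphi.
  have := (is_weak_derivativeE lP lg).1 wP _ tphi.
  move=> E1 E2; under [X in J _ _ X]eq_fun do rewrite mulrBl.
  by rewrite JB ?E1 ?E2 ?subrr//; exact: L2_on_mul.
move=> x y x0 xy y1; rewrite -(Pg x y)//.
have := D0 x; have := D0 y.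
rewrite x0 y1 (le_trans x0 xy) (le_trans xy y1) => /(_ isT) e1 /(_ isT) e2.
by apply/eqP; rewrite subr_eq addrAC -subr_eq; apply/eqP; lra.
Qed.

(** By Lebesgue differentiation, g - h is almost everywhere the derivative of its indefinite
    integral, which vanishes. This identifies the representative picked by [weak_derivative]. *)
Lemma ae_eq_primitive g h : int_on 0 1 g -> int_on 0 1 h ->
  (forall x, 0 <= x <= 1 -> J 0 x g = J 0 x h) ->
  ae_eq mu `]0, 1[%classic g h.
Proof.
move=> ig ih gh.
pose D : set R := `[0, 1]%classic.
have mD : measurable (D : set (measurableTypeR R)) by exact: measurable_itv.
pose f := (fun x => g x - h x) \_ D.
have igh : int_on 0 1 (fun x => g x - h x) by exact: int_onB.
have fT : mu.-integrable [set: R] (EFin \o f).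
  by rewrite -restrict_EFin; apply/(integrable_restrict mu mD measurableT); rewrite setTI.
have fy y : mu.-integrable [set` Interval (BLeft 0) (BRight y)] (EFin \o f).
  exact: integrableS fT.
have := FTC1 fy (integrable_locally mD igh).
apply: filterS; first exact: (ae_filter_ringOfSetsType mu).
move=> x /= F x01.
have /andP[x0 x1] : 0 < x < 1 by move: x01; rewrite /= in_itv.
have [_] : derivable (fun x => J 0 x f) x 1 /\ derive1 (fun x => J 0 x f) x = f x.
  by apply: F; rewrite lte_fin.
rewrite /f patchE ifT; last by rewrite inE /D/= in_itv/= !ltW.
rewrite derive1E (@near_eq_derive _ _ _ _ (cst 0)).
  by rewrite derive_cst => /esym/eqP; rewrite subr_eq0 => /eqP.
near=> y.
have y0 : 0 < y by near: y; exact: lt_nbhsr.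
have y1 : y < 1 by near: y; exact: lt_nbhsl.
rewrite (@J_eq _ 0 y _ (fun x => g x - h x)).
  rewrite JB.
  - by rewrite gh ?subrr//= !ltW.
  - by apply: int_onS ig => //; exact: ltW.
  - by apply: int_onS ih => //; exact: ltW.
move=> t /andP[t0 ty]; rewrite patchE ifT// inE /D/= in_itv/= t0/=.
exact: le_trans (ltW y1).
Unshelve. all: by end_near. Qed.

End WeakDerivatives.

(** * Almost everywhere limits of rapidly Cauchy sequences *)

Section FastCauchy.
Context {R : realType}.
Implicit Types (f g : R -> R) (h : nat -> R -> R) (x : R).
Local Notation mu := (@lebesgue_measure R).
Local Notation J := integral_from_to.
Local Notation D := (`[0%R, 1%R]%classic : set R).

(** Where it is finite the sequence converges, and together with |h 0| it dominates every [h n]. It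
    is extended real because finiteness is only known almost everywhere. *)
Definition total_jump h x : \bar R := (\sum_(0 <= n <oo) `|h n.+1 x - h n x|%:E)%E.

Lemma J_EFin f : int_on 0 1 f -> (\int[mu]_(x in D) (f x)%:E)%E = (J 0 1 f)%:E.
Proof.
by move=> fi; rewrite /J /Rintegral fineK//; apply: integrable_fin_num.
Qed.

Lemma total_jump_sum h x n :
  ((\sum_(0 <= k < n) `|h k.+1 x - h k x|)%:E <= total_jump h x)%E.
Proof.
by rewrite -sumEFin; apply: nneseries_lim_ge => k _ _; rewrite lee_fin.
Qed.

Lemma total_jump_le h x n :
  (`|h n x|%:E <= `|h 0%N x|%:E + total_jump h x)%E.
Proof.
apply: (@le_trans _ _ (`|h 0%N x|%:E +
    (\sum_(0 <= k < n) `|h k.+1 x - h k x|)%:E)%E).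
  rewrite -EFinD lee_fin.
  elim: n => [|n IH]; first by rewrite big_geq// addr0.
  rewrite big_nat_recr//= addrA.
  have := ler_normD (h n x) (h n.+1 x - h n x); rewrite subrKC.
  by move=> /le_trans; apply; rewrite lerD2r.
by rewrite leeD2l// total_jump_sum.
Qed.

Lemma total_jump_cvg h x : (total_jump h x < +oo)%E -> cvgn (h ^~ x).
Proof.
move=> hx.
have : cvgn (series (fun k => `|h k.+1 x - h k x|)) by exact: nnseries_is_cvg.
move=> /(@normed_cvg _ R (fun k => h k.+1 x - h k x)) hc.
have -> : h^~ x = (fun n => h 0%N x + series (fun k => h k.+1 x - h k x) n).
  apply/funext => n; have /(congr1 (fun u => u n)) := @telescopeK R (h ^~ x).
  by rewrite /telescope /= => ->; rewrite subrKC.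
by apply: is_cvgD => //; exact: is_cvg_cst.
Qed.

(* An L^1 limit along a sequence with summable increments is also an almost
   everywhere limit; Fatou's lemma then bounds the energy. *)
Lemma fast_cauchy_limit h (c S : R) : (forall n, L2_on 0 1 (h n)) ->
  (forall n, J 0 1 (fun x => `|h n.+1 x - h n x|) <= c / (2 ^ n.+1)%:R) ->
  (forall n, J 0 1 (fun x => h n x ^+ 2) <= S + (4 ^+ n)^-1) ->
  exists g, [/\ L2_on 0 1 g, J 0 1 (fun x => g x ^+ 2) <= S &
    forall e, 0 < e -> exists N, forall n, (N <= n)%N ->
      J 0 1 (fun x => `|h n x - g x|) <= e].
Proof.
move=> lh hc hS.
have mD : measurable (D : set (measurableTypeR R)) by exact: measurable_itv.
have ih n := L2_on_int (lh n).
have mh n : measurable_fun D (h n) by case: (lh n).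
have idh n : int_on 0 1 (fun x => `|h n.+1 x - h n x|).
  by apply: int_on_norm; exact: int_onB.
have c0 : 0 <= c.
  have := le_trans (J_ge0 _) (hc 0%N); rewrite pmulr_lge0 ?invr_gt0 ?ltr0n// => -> //.
have mdh n : measurable_fun D (fun x => `|h n.+1 x - h n x|%:E).
  by apply/measurable_EFinP; exact: int_on_meas (idh n).
have mF : measurable_fun D (total_jump h).
  apply: (@ge0_emeasurable_sum _ _ _ _ (fun n x => `|h n.+1 x - h n x|%:E) xpredT).
  - by move=> n x _ _; rewrite lee_fin.
  - by move=> n _.
have F0 x : (0 <= total_jump h x)%E by apply: nneseries_ge0 => n _ _; rewrite lee_fin.
have iF : mu.-integrable D (total_jump h).
  apply/integrableP; split => //.
  under eq_integral do rewrite gee0_abs//.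
  rewrite integral_nneseries//.
  apply: (@le_lt_trans _ _ c%:E); last exact: ltry.
  apply: le_trans (epsilon_trick0 xpredT c0); apply: lee_nneseries.
    by move=> n _ _; apply: integral_ge0 => x _; rewrite lee_fin.
  by move=> n _; rewrite J_EFin// lee_fin.
(* The upper limit is measurable without any convergence assumption, and equals the limit wherever
   the latter exists; [fine] only alters infinite values, which occur on a null set. *)
pose g x := fine (limn_esup (fun n => (h n x)%:E)).
have mg : measurable_fun D g.
  apply: (@measurableT_comp _ _ _ _ _ _ (fine : \bar R -> R)).
    exact: fine_measurable.
  apply: measurable_fun_limn_esup => n; exact/measurable_EFinP.
have hg : \forall x \ae mu, D x -> h n x @[n --> \oo] --> g x.
  have := integrable_ae mD iF.
  apply: filterS.
  move=> x /[apply]; rewrite ge0_fin_numE// => /total_jump_cvg hx.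
  rewrite /g.
  have /cvg_limn_einf_sup[_ ->] : (h n x)%:E @[n --> \oo] --> (limn (h^~ x))%:E.
    by apply: cvg_EFin; [exact: nearW|exact: hx].
  exact: hx.
have ig0 : mu.-integrable D (fun x => (`|h 0%N x|)%:E + total_jump h x)%E.
  by apply: integrableD => //; exact: (int_on_norm (ih 0%N)).
have mhE n : measurable_fun D (fun x => (h n x)%:E) by exact/measurable_EFinP.
have mgE : measurable_fun D (fun x => (g x)%:E) by exact/measurable_EFinP.
have hgE : \forall x \ae mu, D x -> (h n x)%:E @[n --> \oo] --> (g x)%:E.
  move: hg; apply: filterS; first exact: (ae_filter_ringOfSetsType mu).
  move=> x /[apply] hx.
  by apply: cvg_EFin; [exact: nearW|exact: hx].
have hdom : \forall x \ae mu, forall n, D x ->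
    (`|(h n x)%:E| <= (`|h 0%N x|)%:E + total_jump h x)%E.
  by apply: aeW => x n _; exact: total_jump_le.
have [ig hg1 _] := @dominated_convergence _ _ _ mu D mD (fun n x => (h n x)%:E)
  (fun x => (g x)%:E) (fun x => (`|h 0%N x|)%:E + total_jump h x)%E
  mhE mgE
  hgE ig0
  hdom.
have f2 : (\int[mu]_(x in D) ((g x) ^+ 2)%:E <= S%:E)%E.
  have m2 n : measurable_fun D (fun x => (h n x ^+ 2)%:E).
    by apply/measurable_EFinP; exact: measurable_funX.
  have -> : (\int[mu]_(x in D) ((g x) ^+ 2)%:E =
      \int[mu]_(x in D) limn_einf (fun n => (h n x ^+ 2)%:E))%E.
    apply: ae_eq_integral => //.
    - by apply/measurable_EFinP; exact: measurable_funX.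
    - have -> : (fun x => limn_einf (fun n => (h n x ^+ 2)%:E)) =
          (fun x => - limn_esup (fun n => - (h n x ^+ 2)%:E))%E.
        by apply/funext => x; rewrite -[LHS]oppeK -limn_esupN.
      apply: measurableT_comp => //; apply: measurable_fun_limn_esup => n.
      by apply: measurableT_comp => //; exact: m2.
    - move: hg; apply: filterS; first exact: (ae_filter_ringOfSetsType mu).
      move=> x /[apply] hx.
      have /cvg_limn_einf_sup[-> _] : (h n x ^+ 2)%:E @[n --> \oo] --> (g x ^+ 2)%:E.
        apply: cvg_EFin; first exact: nearW.
        exact: (cvgM hx hx).
      by [].
  apply: le_trans (fatou mu mD m2 _) _.
    by move=> n x _; rewrite lee_fin sqr_ge0.
  rewrite limn_einf_lim.
  have cS : (S + (4 ^+ n)^-1)%:E @[n --> \oo] --> S%:E.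
    apply: cvg_EFin; first exact: nearW.
    rewrite -[X in _ --> X]addr0; apply: cvgD; first exact: cvg_cst.
    under eq_fun do rewrite -exprVn.
    by apply: cvg_expr; rewrite ger0_norm ?invr_ge0// invf_lt1// ltr1n.
  rewrite -(cvg_lim _ cS)//; apply: lee_lim; [exact: is_cvg_einfs|by apply/cvg_ex; exists S%:E|].
  apply: nearW => n; apply: (@le_trans _ _ (\int[mu]_(x in D) (h n x ^+ 2)%:E)%E).
    by apply: ereal_inf_lbound; exists n => //=.
  by rewrite J_EFin ?lee_fin//; case: (lh n).
have lg : L2_on 0 1 g.
  split => //; apply/integrableP; split.
    by apply/measurable_EFinP; exact: measurable_funX.
  apply: le_lt_trans (ltry S); apply: le_trans f2.
  rewrite le_eqVlt; apply/orP; left; apply/eqP; apply: eq_integral => x _ /=.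
  by rewrite ger0_norm ?sqr_ge0.
exists g; split => //.
  by have := f2; rewrite J_EFin ?lee_fin//; case: lg.
move=> e e0.
have ihg n : int_on 0 1 (fun x => `|h n x - g x|).
  by apply: int_on_norm; apply: int_onB => //; exact: L2_on_int.
have hJ n : (\int[mu]_(x in D) `|(h n x)%:E - (g x)%:E|)%E =
   (J 0 1 (fun x => `|h n x - g x|))%:E by rewrite -J_EFin.
have : (J 0 1 (fun x => `|h n x - g x|))%:E @[n --> \oo] --> 0%E.
  by move: hg1; under eq_fun do rewrite hJ.
move=> /fine_cvgP[_] /cvgr0Pnorm_le/(_ _ e0)[N _ hN].
by exists N => n /hN; apply: le_trans; exact: ler_norm.
Qed.
End FastCauchy.

(** * Lower semicontinuity of the Dirichlet energy under uniform convergence *)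

Section EnergyLimit.
Context {R : realType}.
Implicit Types (f g h w : R -> R) (x K S e : R).
Local Notation J := integral_from_to.

Definition approximates w e h :=
  L2_on 0 1 h /\ forall x, 0 <= x <= 1 -> `|J 0 x h - w x| <= e.

(** The parallelogram law, written with the energy of the midpoint, the quantity that an infimum
    over a convex set bounds from below. *)
Lemma J_sqr_average f g : L2_on 0 1 f -> L2_on 0 1 g ->
  J 0 1 (fun x => (f x - g x) ^+ 2) =
  2 * J 0 1 (fun x => f x ^+ 2) + 2 * J 0 1 (fun x => g x ^+ 2) -
  4 * J 0 1 (fun x => (2^-1 * (f x + g x)) ^+ 2).
Proof.
move=> lf lg.
have [_ if2] := lf; have [_ ig2] := lg.
have [_ ia2] := L2_onZ 2^-1 (L2_onD lf lg).
rewrite -!JZ// -JD; [|exact: int_onZ..].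
rewrite -JB; [|by apply: int_onD; exact: int_onZ|exact: int_onZ].
by apply: J_eq => x _; field.
Qed.

Lemma approximates_average w e1 e2 e f g : approximates w e1 f ->
  approximates w e2 g -> e1 <= e -> e2 <= e ->
  approximates w e (fun x => 2^-1 * (f x + g x)).
Proof.
move=> [lf fw] [lg gw] e1e e2e; split; first exact/L2_onZ/L2_onD.
move=> x x01.
have [i1 i2] : int_on 0 x f /\ int_on 0 x g.
  by split; [apply: int_onS (L2_on_int lf)|apply: int_onS (L2_on_int lg)];
    case/andP: x01.
rewrite JZ ?JD//; last exact: int_onD.
rewrite (_ : _ - _ = 2^-1 * ((J 0 x f - w x) + (J 0 x g - w x))); last by field.
rewrite normrM ger0_norm ?invr_ge0// ler_pdivrMl//.
rewrite (le_trans (ler_normD _ _))//.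
have := fw x x01; have := gw x x01; lra.
Qed.

Lemma approximates_lim w (h : nat -> R -> R) g : L2_on 0 1 g ->
  (forall n : nat, approximates w n.+1%:R^-1 (h n)) ->
  (forall e, 0 < e -> exists N, forall n, (N <= n)%N ->
      J 0 1 (fun x => `|h n x - g x|) <= e) ->
  forall x, 0 <= x <= 1 -> w x = J 0 x g.
Proof.
move=> lg hw hg x /andP[x0 x1].
have ig := L2_on_int lg.
apply/eqP; rewrite -subr_eq0 -normr_le0; apply/ler_addgt0Pr => e e0.
rewrite add0r.
have e20 : 0 < e / 2 by rewrite divr_gt0.
have [N hN] := hg _ e20.
pose n := maxn N (Num.truncn (e / 2)^-1).
have nN : (N <= n)%N by exact: leq_maxl.
have ne : n.+1%:R^-1 <= e / 2.
  rewrite -[leRHS]invrK lef_pV2 ?posrE ?invr_gt0 ?ltr0n//.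
  apply: le_trans (ltW (Num.Theory.truncnS_gt _)) _.
  by rewrite ler_nat ltnS leq_maxr.
have [lh hwx] := hw n.
have ih := L2_on_int lh.
have h1 : `|J 0 x (h n) - w x| <= e / 2.
  by apply: le_trans ne; apply: hwx; rewrite x0.
have h2 : `|J 0 x (h n) - J 0 x g| <= e / 2.
  have ihg : int_on 0 1 (fun x => h n x - g x) by exact: int_onB.
  have sub (k : R -> R) : int_on 0 1 k -> int_on 0 x k by exact: int_onS.
  rewrite -JB; [|exact: sub..].
  rewrite (le_trans (J_norm (sub _ ihg)))// (le_trans _ (hN _ nN))//.
  by apply: J_le_sub => //; exact: int_on_norm.
rewrite (_ : w x - _ = (J 0 x (h n) - J 0 x g) - (J 0 x (h n) - w x)); last by ring.
by rewrite (le_trans (ler_normB _ _))//; lra.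
Qed.

(* Almost minimisers of the energy among the functions whose primitive is
   uniformly close to w form a Cauchy sequence, by the parallelogram law and
   the convexity of the closeness constraint. *)
Lemma energy_limit w K :
  (forall e, 0 < e -> exists2 h, approximates w e h &
     J 0 1 (fun x => h x ^+ 2) <= K + e) ->
  exists g, [/\ L2_on 0 1 g, forall x, 0 <= x <= 1 -> w x = J 0 x g &
    J 0 1 (fun x => g x ^+ 2) <= K].
Proof.
move=> wK.
pose en h := J 0 1 (fun x => h x ^+ 2).
pose E (n : nat) := inf [set en h | h in [set h | approximates w n.+1%:R^-1 h]].
have n0 (n : nat) : 0 < n.+1%:R^-1 :> R by rewrite invr_gt0 ltr0n.
have lbE n : lbound [set en h | h in [set h | approximates w n.+1%:R^-1 h]] 0.
  by move=> _ [h _ <-]; apply: J_ge0 => x _; exact: sqr_ge0.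
have hiE n : has_inf [set en h | h in [set h | approximates w n.+1%:R^-1 h]].
  split; last by exists 0.
  by have [h hw _] := wK _ (n0 n); exists (en h), h.
have E_le n h e : approximates w e h -> e <= n.+1%:R^-1 -> E n <= en h.
  move=> [lh hw] en1; apply: ge_inf; first by exists 0.
  exists h => //; split => // x /hw; move/le_trans; exact.
have EK n : E n <= K.
  apply/ler_addgt0Pr => e e0.
  have m0 : 0 < Num.min e n.+1%:R^-1 by rewrite lt_min e0 n0.
  have [h hw hK] := wK _ m0.
  apply: le_trans (E_le n h _ hw _) _; first by rewrite ge_min lexx orbT.
  by apply: le_trans hK _; rewrite lerD2l ge_min lexx.
have Emono m n : (m <= n)%N -> E m <= E n.
  move=> mn; apply: lb_le_inf; first by case: (hiE n).
  move=> _ [h hw <-]; apply: E_le hw _.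
  by rewrite lef_pV2 ?posrE ?ltr0n// ler_nat ltnS.
(* Tightening the tolerance raises the infimum [E n], which stays below [K]; [S] is the limiting
   energy level. *)
pose S := sup (range E).
have hsE : has_sup (range E).
  by split; [exists (E 0%N), 0%N|exists K => _ [n _ <-]].
have ES n : E n <= S by apply: sup_upper_bound => //; exists n.
have SK : S <= K by apply: ge_sup => [|_ [n _ <-]//]; exists (E 0%N), 0%N.
have d0 (k : nat) : 0 < (4 ^+ k)^-1 :> R by rewrite invr_gt0 exprn_gt0.
(* The margin 4^-k in energy makes consecutive L^2 distances of order 2^-k, hence summable. *)
have : forall k : nat, exists hn : (R -> R) * nat,
    [/\ (k <= hn.2)%N, S - (4 ^+ k)^-1 < E hn.2,
        approximates w hn.2.+1%:R^-1 hn.1 & en hn.1 < E hn.2 + (4 ^+ k)^-1].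
  move=> k.
  have [_ [N _ <-] SN] := sup_adherent (d0 k) hsE.
  have [_ [h hw <-] hE] := inf_adherent (d0 k) (hiE (maxn N k)).
  exists (h, maxn N k); split => //=; first exact: leq_maxr.
  by apply: lt_le_trans SN _; apply: Emono; exact: leq_maxl.
move=> /choice[hn hnP].
pose h k := (hn k).1; pose n k := (hn k).2.
have hw k : approximates w (n k).+1%:R^-1 (h k) by case: (hnP k).
have lh k : L2_on 0 1 (h k) by case: (hw k).
have hS k : en (h k) <= S + (4 ^+ k)^-1.
  case: (hnP k) => _ _ _ /ltW/le_trans; apply; rewrite lerD2r; exact: ES.
have hdiff k : J 0 1 (fun x => (h k.+1 x - h k x) ^+ 2) <= 8 * (4 ^+ k)^-1.
  rewrite J_sqr_average//.
  (* The midpoint obeys only the looser of the two tolerances, so [m] is the smaller index. The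
     parallelogram law then leaves (2 + 1/2 + 4) 4^-k, below the bound 8 4^-k. *)
  have [m [m1 m2 Em]] : exists m, [/\ (n k).+1%:R^-1 <= m.+1%:R^-1 :> R,
      (n k.+1).+1%:R^-1 <= m.+1%:R^-1 :> R & S - (4 ^+ k)^-1 <= E m].
    have k4 : (4 ^+ k.+1)^-1 <= (4 ^+ k)^-1 :> R.
      by rewrite lef_pV2 ?posrE ?exprn_gt0// ler_weXn2l// ler1n.
    have [mn|nm] := leqP (n k) (n k.+1).
      exists (n k); split => //; last by case: (hnP k) => _ /ltW.
      by rewrite lef_pV2 ?posrE ?ltr0n// ler_nat ltnS.
    exists (n k.+1); split => //.
      by rewrite lef_pV2 ?posrE ?ltr0n// ler_nat ltnS ltnW.
    by case: (hnP k.+1) => _ /ltW h4 _ _; apply: le_trans h4; rewrite lerD2l lerN2.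
  have := E_le m _ _ (approximates_average (hw k.+1) (hw k) m2 m1) (lexx _).
  move=> Ea.
  have h1 := hS k; have h2 := hS k.+1.
  have k4 : (4 ^+ k.+1)^-1 = 4^-1 * (4 ^+ k)^-1 :> R by rewrite exprS invfM.
  have := d0 k; rewrite k4 in h2; rewrite /en /= in Ea h1 h2; lra.
(* By Cauchy-Schwarz the square is at most 8 4^-k <= (3 2^-k)^2. *)
have hc k : J 0 1 (fun x => `|h k.+1 x - h k x|) <= 6 / (2 ^ k.+1)%:R.
  have lhd := L2_onB (lh k.+1) (lh k).
  have ln : L2_on 0 1 (fun x => `|h k.+1 x - h k x|).
    split; first by apply: measurableT_comp => //; case: lhd.
    under eq_fun do rewrite real_normK ?num_real//; by case: lhd.
  have := J_cauchy_schwarz ler01 ln.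
  rewrite subr0 mul1r (@J_eq _ 0 1 (fun x => `|h k.+1 x - h k x| ^+ 2)
    (fun x => (h k.+1 x - h k x) ^+ 2)); last first.
    by move=> x _ /=; rewrite real_normK ?num_real.
  move=> /le_trans/(_ (hdiff k)) hA.
  have -> : 6 / (2 ^ k.+1)%:R = 3 * (2 ^+ k)^-1 :> R.
    by rewrite natrX exprS; field; rewrite expf_neq0.
  rewrite -(@ler_pXn2r _ 2) ?nnegrE//.
  - apply: le_trans hA _; rewrite exprMn.
    have -> : (4 ^+ k)^-1 = (2 ^+ k)^-1 ^+ 2 :> R.
      by rewrite -exprVn -[in RHS]exprVn -exprM mulnC exprM; congr (_ ^+ k); field.
    by rewrite ler_wpM2r ?sqr_ge0//; lra.
  - by apply: J_ge0 => x _.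
have [g [lg gS hg]] := fast_cauchy_limit lh hc hS.
exists g; split => //; last exact: le_trans gS SK.
apply: approximates_lim lg _ hg => k.
have [lhk hwk] := hw k; split => // x /hwk; move/le_trans; apply.
by case: (hnP k) => kn _ _ _; rewrite lef_pV2 ?posrE ?ltr0n// ler_nat ltnS.
Qed.

End EnergyLimit.

(** * The kernel and its primitive G *)

Section Kernel.
Context {R : realType}.
Implicit Types (a b c r s t : R).
Local Notation mu := (@lebesgue_measure R).
Local Notation J := integral_from_to.

Definition kern t : R := ((1 + t ^+ 2) `^ (5 / 4))^-1.

Lemma base_gt0 t : 0 < 1 + t ^+ 2.
Proof. by rewrite ltr_pwDl// sqr_ge0. Qed.

Lemma base_ge1 t : 1 <= 1 + t ^+ 2.
Proof. by rewrite lerDl sqr_ge0. Qed.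

Lemma kern_gt0 t : 0 < kern t.
Proof. by rewrite invr_gt0 powR_gt0// base_gt0. Qed.

Lemma kern_le1 t : kern t <= 1.
Proof.
rewrite invf_le1 ?powR_gt0 ?base_gt0//.
have h : 0 <= 5 / 4 :> R by rewrite divr_ge0.
by have := ler_powR (base_ge1 t) h; rewrite powRr0.
Qed.

Lemma kernN t : kern (- t) = kern t.
Proof. by rewrite /kern sqrrN. Qed.

Lemma kern_le c t : `|t| <= c -> kern c <= kern t.
Proof.
move=> tc; rewrite lef_pV2 ?posrE ?powR_gt0 ?base_gt0//.
apply: ge0_ler_powR; rewrite ?nnegrE ?(ltW (base_gt0 _)) ?divr_ge0//.
rewrite lerD2l -real_normK ?num_real//.
by apply: lerXn2r; rewrite ?nnegrE// (le_trans _ tc).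
Qed.

Lemma kern_sqr t : kern t ^+ 2 = ((1 + t ^+ 2) `^ (5 / 2))^-1.
Proof.
rewrite /kern exprVn expr2 -powRD; first by congr (_ `^ _)^-1; field.
by rewrite gt_eqF ?base_gt0 ?implybT.
Qed.

Lemma is_derive_kern t :
  is_derive t (1 : R) kern (- (5 / 4) * (1 + t ^+ 2) `^ (- (5 / 4) - 1) * (2 * t)).
Proof.
have db : is_derive t (1 : R) (fun t => 1 + t ^+ 2) (2 * t).
  have := is_deriveD (is_derive_cst (1 : R) t 1) (is_deriveX 2 (is_derive_id t (1 : R))).
  move=> /is_derive_eq; apply; rewrite add0r /GRing.scale/= expr1 mulr1//.
have := @is_derive1_comp R (fun y => y `^ (- (5 / 4))) (fun t => 1 + t ^+ 2) t _ _
  (is_derive1_powR _ (base_gt0 t)) db.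
rewrite (_ : _ \o _ = kern)//.
by apply/funext => x /=; rewrite powRN.
Qed.

Lemma continuous_kern : continuous kern.
Proof. exact: derivable_continuous is_derive_kern. Qed.

(** The power is at most 1/(1 + t^2) and 2|t| <= 1 + t^2, so 5/4 would do; 2 is a round bound. *)
Lemma kern_deriv_le t :
  `|- (5 / 4) * (1 + t ^+ 2) `^ (- (5 / 4) - 1) * (2 * t)| <= 2.
Proof.
have h : (1 + t ^+ 2) `^ (- (5 / 4) - 1) <= (1 + t ^+ 2)^-1.
  rewrite -(powR_inv1 (ltW (base_gt0 t))).
  by apply: ler_powR; [exact: base_ge1|lra].
set P := _ `^ _ in h *.
have P0 : 0 <= P by exact: powR_ge0.
have {}h : P * (2 * `|t|) <= 1.
  have t2 : 2 * `|t| <= 1 + t ^+ 2.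
    by rewrite -real_normK ?num_real//; have := sqr_ge0 (`|t| - 1); lra.
  apply: le_trans (ler_pM _ _ h t2) _ => //.
  by rewrite mulVf// gt_eqF// base_gt0.
rewrite (_ : _ * _ = - ((5 / 4) * P * 2) * t); last by ring.
have c0 : 0 <= 5 / 4 * P * 2 by lra.
rewrite normrM normrN (ger0_norm c0); lra.
Qed.

Lemma kern_lip s t : `|kern s - kern t| <= 2 * `|s - t|.
Proof.
wlog ts : s t / t <= s => [hw|].
  have [/hw//|/ltW/hw] := leP t s; by rewrite distrC [X in _ * X]distrC.
have [c _ ->] := @MVT_segment R kern _ t s ts (fun x _ => is_derive_kern x)
  (@within_cont R t s _ continuous_kern).
by rewrite normrM ler_wpM2r// kern_deriv_le.
Qed.

Lemma int_on_kern a b : int_on a b kern.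
Proof. exact/int_on_cont/within_cont/continuous_kern. Qed.

(* The integral over [0, s], with sign: one of the two integrals is over the
   empty interval. *)
Definition Gfun s : R := J 0 s kern - J s 0 kern.

Lemma J_empty a b (f : R -> R) : b < a -> J a b f = 0.
Proof. by move=> ba; rewrite /J set_itv_ge ?Rintegral_set0// bnd_simp -ltNge. Qed.

Lemma J_le0 a b (f : R -> R) : b <= a -> J a b f = 0.
Proof. by rewrite le_eqVlt => /predU1P[->|/J_empty//]; exact: J_pt. Qed.

Lemma Gfun_sub s t : t <= s -> Gfun s - Gfun t = J t s kern.
Proof.
move=> ts; rewrite /Gfun.
have [t0|t0] := leP 0 t.
  rewrite (@J_le0 s)// ?(le_trans t0)// (@J_le0 t 0)// !subr0.
  rewrite (@J_cat _ 0 t s)//; last exact: int_on_kern.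
  by ring.
rewrite (@J_le0 0 t) ?ltW//.
have [s0|s0] := leP 0 s.
  rewrite (@J_le0 s 0)//.
  rewrite (@J_cat _ t 0 s) ?(ltW t0)//; last exact: int_on_kern.
  by ring.
rewrite (@J_le0 0 s) ?ltW//.
rewrite (@J_cat _ t s 0) ?(ltW s0)//; last exact: int_on_kern.
by ring.
Qed.

Lemma GfunN s : Gfun (- s) = - Gfun s.
Proof.
have refl a : 0 <= a -> J (- a) 0 kern = J 0 a kern.
  move=> a0.
  have := integration_by_substitution_oppr a0 (@within_cont R _ _ _ continuous_kern).
  have -> : kern \o -%R = kern by apply/funext => x; exact: kernN.
  by rewrite oppr0 => /(congr1 fine).
rewrite /Gfun opprB; have [s0|s0] := leP 0 s.
  by rewrite refl// (@J_le0 0) ?oppr_le0// (@J_le0 s 0)// opprK; ring.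
have ns0 : 0 <= - s by rewrite oppr_ge0 ltW.
by rewrite (@J_le0 (- s) 0)// (@J_le0 0 s) ?(ltW s0)// -(refl _ ns0) opprK.
Qed.

Lemma Gfun0 : Gfun 0 = 0.
Proof. by rewrite /Gfun J_pt subrr. Qed.

Lemma Gfun_mono s t : t <= s -> Gfun t <= Gfun s.
Proof.
move=> ts; rewrite -subr_ge0 Gfun_sub//; apply: J_ge0 => x _.
exact/ltW/kern_gt0.
Qed.

Lemma Gfun_lip s t : `|Gfun s - Gfun t| <= `|s - t|.
Proof.
wlog ts : s t / t <= s => [hw|].
  have [/hw//|/ltW/hw] := leP t s; by rewrite distrC [X in _ <= X]distrC.
rewrite Gfun_sub// [leRHS]ger0_norm ?subr_ge0// -[leRHS]mul1r.
apply: J_le_norm_cst => //; first exact: int_on_kern.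
by move=> x _; rewrite ger0_norm ?kern_le1// ltW// kern_gt0.
Qed.

(** The kernel decreases in |t|, so it is at least [kern c] on [-c, c]. This Lipschitz bound for the
    inverse of G turns control of G(p) into control of p. *)
Lemma Gfun_ge c s t : `|s| <= c -> `|t| <= c ->
  kern c * `|s - t| <= `|Gfun s - Gfun t|.
Proof.
wlog ts : s t / t <= s => [hw sc tc|].
  have [/hw|/ltW/hw] := leP t s; first exact.
  by rewrite (distrC t s) (distrC (Gfun t)); apply.
rewrite !ler_norml => /andP[s1 s2] /andP[t1 t2].
rewrite Gfun_sub// ger0_norm ?subr_ge0// -J_cst//.
apply: le_trans (ler_norm _); apply: J_le => //; [exact: int_on_cst|exact: int_on_kern|].
move=> x /andP[tx xs]; apply: kern_le; rewrite ler_norml; apply/andP; split; lra.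
Qed.

Lemma Gfun_taylor s t : `|Gfun s - Gfun t - kern t * (s - t)| <= 2 * (s - t) ^+ 2.
Proof.
(* The point [c] is left free because the expansion point [t] may be either the left or the right
   end. *)
have main a b c : a <= b -> a <= c <= b ->
    `|J a b kern - kern c * (b - a)| <= 2 * (b - a) ^+ 2.
  move=> ab cab; rewrite -J_cst// -JB//; [|exact: int_on_kern|exact: int_on_cst].
  rewrite expr2 mulrA; apply: J_le_norm_cst => //.
    by apply: int_onB; [exact: int_on_kern|exact: int_on_cst].
  move=> x xab; rewrite (le_trans (kern_lip _ _))// ler_wpM2l//.
  by move: xab cab => /andP[? ?] /andP[? ?]; rewrite ler_norml; apply/andP; split; lra.
have [ts|/ltW ts] := leP t s.
  by rewrite Gfun_sub//; apply: main; rewrite ?lexx.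
rewrite (_ : (s - t) ^+ 2 = (t - s) ^+ 2); last by ring.
rewrite -normrN (_ : - (Gfun s - Gfun t - kern t * (s - t)) =
  Gfun t - Gfun s - kern t * (t - s)); last by ring.
by rewrite Gfun_sub//; apply: main => //; rewrite ts lexx.
Qed.

(** Otherwise monotone convergence bounds the integral of the kernel over the half line by r, and
    evenness gives c0 <= 2 r. *)
Lemma Gfun_gt r : 0 <= r -> r < c0 R / 2 -> exists2 c, 0 < c & r < Gfun c.
Proof.
move=> r0 rc; apply/not_exists2P => H.
have Hn n : J 0 n%:R kern <= r.
  (* [H] informs only about positive arguments, so the case n = 0 is reached through [n.+1] and
     monotonicity. *)
  have [c_le|] := H n.+1%:R; first by rewrite ltr0n in c_le.
  move=> /negP; rewrite -leNgt; apply: le_trans.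
  apply: le_trans (@Gfun_mono n.+1%:R n%:R _); last by rewrite ler_nat.
  by rewrite /Gfun (@J_le0 n%:R 0)// subr0.
have k0 x : 0 <= kern x by exact/ltW/kern_gt0.
have mk : measurable_fun [set: R] kern.
  exact: continuous_measurable_fun continuous_kern.
have hcv : (\int[mu]_(x in `[0%R, n%:R]) (kern x)%:E)%E @[n --> \oo] -->
    (\int[mu]_(x in `[0%R, +oo[) (kern x)%:E)%E by exact: ge0_cvgn_integral.
have hle : (\int[mu]_(x in `[0%R, +oo[) (kern x)%:E <= r%:E)%E.
  rewrite -(cvg_lim _ hcv)//; apply: lime_le; first by apply/cvg_ex; eexists; exact: hcv.
  apply: nearW => n.
  rewrite -(fineK (integrable_fin_num _ (int_on_kern 0 n%:R)))//.
  by rewrite lee_fin; exact: Hn.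
have kT : (\int[mu]_x (kern x)%:E <= (2 * r)%:E)%E.
  rewrite (ge0_symfun_integralT k0 continuous_kern); last first.
    by move=> x; rewrite /= kernN.
  by rewrite -set_itvcy EFinM; apply: lee_wpmul2l.
suff : c0 R <= 2 * r by lra.
rewrite /c0 /Rintegral -[leRHS]/(fine (2 * r)%:E); apply: fine_le => //.
rewrite ge0_fin_numE; first exact: le_lt_trans kT (ltry _).
by apply: integral_ge0 => x _; rewrite lee_fin k0.
Qed.

End Kernel.

(** * Uniform cluster points of equi-Hoelder sequences *)

Lemma ultra_fmap (T T' : Type) (f : T -> T') (F : set_system T) :
  UltraFilter F -> UltraFilter (fmap f F).
Proof.
move=> FU; split; first exact: fmap_proper_filter.
move=> G GF sFG; apply/seteqP; split => A; last exact: sFG.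
move=> GA; have [//|FnA] := in_ultra_setVsetC (f @^-1` A) FU.
have /filter_ex[x []//] : G (A `&` ~` A) by apply: filterI => //; exact: sFG.
Qed.

Section EquicontinuousLimit.
Context {R : realType}.
Implicit Types (p : nat -> R -> R) (q : R -> R) (C L e x y : R).

(** Arzela-Ascoli through an ultrafilter refining the tails of the naturals: it yields pointwise
    limits at all points at once, with no diagonal extraction. Finitely many grid points and the
    common modulus of continuity then give uniform closeness for arbitrarily large indices. *)
Lemma equicontinuous_cluster p C L : 0 <= L ->
  (forall n x, 0 <= x <= 1 -> `|p n x| <= C) ->
  (forall n x y, 0 <= x -> x <= y -> y <= 1 ->
     (p n y - p n x) ^+ 2 <= L * (y - x)) ->
  exists q, forall e N, 0 < e -> exists2 n, (N <= n)%N &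
    forall x, 0 <= x <= 1 -> `|p n x - q x| <= e.
Proof.
move=> L0 pC pL.
have [U [UU ooU]] := ultraFilterLemma (@eventually_filter).
have : forall x : R, exists l : R, 0 <= x <= 1 -> p n x @[n --> U] --> l.
  move=> x; have [x01|_] := boolP (0 <= x <= 1); last by exists 0.
  have UI : UltraFilter (fmap (fun n => p n x) U). by exact: ultra_fmap.
  have := @segment_compact R (- C) C; rewrite compact_ultra.
  move=> /(_ _ UI)[|l [_ /= pl]]; last by exists l.
  rewrite /fmap /=; apply: filterS (filterT) => n _ /=.
  by rewrite in_itv/= -ler_norml pC.
move=> /choice[q qP].
have near_q x e : 0 <= x <= 1 -> 0 < e -> U [set n | `|p n x - q x| <= e].
  move=> /qP/cvgrPdist_le/[apply]; apply: filterS => n /=; by rewrite distrC.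
exists q => e N e0.
have e40 : 0 < e / 4 by rewrite divr_gt0.
(* On a mesh of size 1/(m + 1) each [p n] oscillates by at most e/4, and [q] by at most e/4 + e/8 +
   e/8 = e/2; with e/4 at the grid points the total is e. *)
pose m := Num.truncn (L / (e / 4) ^+ 2).
have m0 : 0 < m.+1%:R :> R by rewrite ltr0n.
have Lm : L / m.+1%:R <= (e / 4) ^+ 2.
  rewrite ler_pdivrMr// mulrC -ler_pdivrMr ?exprn_gt0//.
  exact/ltW/Num.Theory.truncnS_gt.
have close n x y : 0 <= x -> x <= y -> y <= 1 -> y - x <= m.+1%:R^-1 ->
    `|p n y - p n x| <= e / 4.
  move=> x0 xy y1 yx; rewrite -(@ler_pXn2r _ 2) ?nnegrE ?(ltW e40)//.
  rewrite real_normK ?num_real// (le_trans (pL n x y x0 xy y1))//.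
  by apply: le_trans Lm; rewrite ler_wpM2l.
(* There are m + 2 nodes, both end points included; a finite intersection of sets of [U] is in
   [U]. *)
have grid k : (k <= m.+2)%N -> U [set n | forall i, (i < k)%N ->
    `|p n (i%:R / m.+1%:R) - q (i%:R / m.+1%:R)| <= e / 4].
  elim: k => [_|k IH km]; first by apply: filterS filterT => n _.
  have km1 : 0 <= (k%:R : R) / m.+1%:R <= 1.
    by rewrite divr_ge0//= ler_pdivrMr// mul1r ler_nat -ltnS.
  apply: filterS (filterI (IH (ltnW km)) (near_q _ _ km1 e40)) => n [h1 h2] i.
  by rewrite ltnS leq_eqVlt => /predU1P[->//|]; exact: h1.
have q_close x y : 0 <= x -> x <= y -> y <= 1 -> y - x <= m.+1%:R^-1 ->
    `|q y - q x| <= e / 2.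
  move=> x0 xy y1 yx; have [yI xI] : 0 <= y <= 1 /\ 0 <= x <= 1.
    by split; apply/andP; split; lra.
  have e80 : 0 < e / 8 by rewrite divr_gt0.
  have [n [h1 h2]] := filter_ex (filterI (near_q _ _ yI e80) (near_q _ _ xI e80)).
  have h3 := close n _ _ x0 xy y1 yx.
  rewrite (_ : q y - q x = (p n y - p n x) - ((p n y - q y) - (p n x - q x))); last by ring.
  rewrite (le_trans (ler_normB _ _))//.
  by have := ler_normB (p n y - q y) (p n x - q x); move: h1 h2 => /= h1 h2; lra.
have UN : U [set n | (N <= n)%N] by apply: ooU; exact: nbhs_infty_ge.
have [n [Nn hn]] := filter_ex (filterI UN (grid _ (leqnn _))).
exists n => // x /andP[x0 x1].
pose i := Num.truncn (x * m.+1%:R).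
have /andP[ix xi] := Num.Theory.truncn_itv (mulr_ge0 x0 (ltW m0)).
rewrite -/i in ix xi.
have xm : i%:R / m.+1%:R <= x by rewrite ler_pdivrMr.
have xm' : x - i%:R / m.+1%:R <= m.+1%:R^-1.
  have : x <= i.+1%:R / m.+1%:R by rewrite ler_pdivlMr// ltW.
  by rewrite -natr1 mulrDl mul1r lerBlDl.
have im : (i < m.+2)%N.
  rewrite ltnS -(@ler_nat R); apply: le_trans ix _.
  by rewrite -[leRHS]mul1r ler_wpM2r// ltW.
have i0 : 0 <= (i%:R : R) / m.+1%:R by rewrite divr_ge0.
set z := i%:R / m.+1%:R in xm xm' i0.
have h1 := hn i im; rewrite -/z in h1.
have h2 := close n _ _ i0 xm x1 xm'.
have h3 := q_close _ _ i0 xm x1 xm'.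
rewrite (_ : p n x - q x = (p n x - p n z) - (q x - q z) + (p n z - q z)); last by ring.
rewrite (le_trans (ler_normD _ _))//.
have := ler_normB (p n x - p n z) (q x - q z); lra.
Qed.

End EquicontinuousLimit.

(** * Admissible functions with their slope and second derivative *)

Section Profiles.
Context {R : realType}.
Implicit Types (f g v w p q : R -> R) (a b c x y : R).
Local Notation mu := (@lebesgue_measure R).
Local Notation J := integral_from_to.

(* p is the slope of v and q its second derivative. *)
Definition profile v p q :=
  [/\ L2_on 0 1 q, primitive_on01 p q, primitive_on01 v p,
      v 0 = 0 /\ v 1 = 0 & p 0 = 0 /\ p 1 = 0].

Lemma profile_cont v p q : profile v p q ->
  {within `[0, 1], continuous p} /\ {within `[0, 1], continuous v}.
Proof.
move=> [lq pq vp _ _].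
have cp := primitive_continuous (L2_on_int lq) pq.
by split => //; exact: primitive_continuous (int_on_cont cp) vp.
Qed.

Lemma weak_derivative_spec f g : L2 g -> is_weak_derivative f g ->
  L2 (weak_derivative f) /\ is_weak_derivative f (weak_derivative f).
Proof.
move=> lg fg.
by have := @xgetPex _ (fun=> 0) [set g | L2 g /\ is_weak_derivative f g]
  (ex_intro _ g (conj lg fg)).
Qed.

Lemma meas_EFin_oo a b x y f : a <= x -> y <= b -> measurable_fun `[a, b] f ->
  measurable_fun (`]x, y[%classic : set R) (EFin \o f).
Proof.
move=> ax yb mf; apply/measurable_EFinP; apply: measurable_funS mf => //.
by apply: subset_itv; rewrite bnd_simp.
Qed.

Lemma J_ae_eq f g : int_on 0 1 f -> int_on 0 1 g ->
  ae_eq mu `]0, 1[%classic f g -> J 0 1 f = J 0 1 g.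
Proof.
move=> fi gi fg; rewrite -!Rintegral_oo// /Rintegral; congr fine.
have sub (h : R -> R) : int_on 0 1 h ->
    measurable_fun (`]0, 1[%classic : set R) (EFin \o h).
  by move=> /int_on_meas; exact: meas_EFin_oo.
apply: ae_eq_integral => //; [exact: sub|exact: sub|].
move: fg; apply: filterS.
by move=> x /= /[apply] ->.
Qed.

Lemma is_weak_derivative_ae f1 f2 g : L2_on 0 1 f1 -> L2_on 0 1 f2 ->
  L2_on 0 1 g -> ae_eq mu `]0, 1[%classic f1 f2 ->
  is_weak_derivative f1 g -> is_weak_derivative f2 g.
Proof.
move=> l1 l2 lg f12 /(is_weak_derivativeE l1 lg) h.
apply/is_weak_derivativeE => // phi tphi; rewrite -h//.
have [_ _ cphi'] := test_function_cont tphi.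
have lphi' := L2_on_cont (@within_cont R 0 1 _ cphi').
apply: J_ae_eq; [exact: L2_on_mul|exact: L2_on_mul|].
move: f12; apply: filterS.
by move=> x /= /[apply] ->.
Qed.

(** The energy depends only on almost everywhere classes, so the representatives chosen by
    [weak_derivative] may be traded for convenient ones; the weight of [W] is the square of
    [kern]. *)
Lemma W_kern v p q : {within `[0, 1], continuous p} -> L2_on 0 1 q ->
  L2_on 0 1 (weak_derivative v) -> L2_on 0 1 (weak_derivative (weak_derivative v)) ->
  ae_eq mu `]0, 1[%classic (weak_derivative v) p ->
  ae_eq mu `]0, 1[%classic (weak_derivative (weak_derivative v)) q ->
  W v = (J 0 1 (fun x => (kern (p x) * q x) ^+ 2))%:E.
Proof.
move=> cp lq; set p' := weak_derivative v; set q' := weak_derivative p'.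
move=> lp' lq' pp qq.
have mk (h1 h2 : R -> R) : measurable_fun (`[0, 1]%classic : set R) h1 ->
    measurable_fun (`[0, 1]%classic : set R) h2 ->
    measurable_fun (`[0, 1]%classic : set R) (fun x : R => (kern (h1 x) * h2 x) ^+ 2).
  move=> m1 m2; apply: measurable_funX; apply: measurable_funM => //.
  apply: (@measurableT_comp _ _ _ _ _ _ kern) => //.
  exact: continuous_measurable_fun continuous_kern.
have WE : W v = (\int[mu]_(x in `]0%R, 1%R[) ((kern (p' x) * q' x) ^+ 2)%:E)%E.
  apply: eq_integral => x _; congr EFin.
  by rewrite exprMn kern_sqr mulrC.
have sub (h : R -> R) : measurable_fun (`[0, 1]%classic : set R) h ->
    measurable_fun (`]0, 1[%classic : set R) (EFin \o h).
  exact: meas_EFin_oo.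
have mpq := mk _ _ (meas_cont cp) (proj1 lq).
rewrite WE (@ge0_ae_eq_integral _ _ _ mu `]0, 1[%classic
    _ (fun x => ((kern (p x) * q x) ^+ 2)%:E)) => //.
- rewrite -(@integral_itv_bndoo _ 0 1 _ true false) => //; last exact: sub mpq.
  rewrite J_EFin//.
  have : L2_on 0 1 (fun x => kern (p x) * q x); last by case.
  apply: (@L2_on_bounded _ _ _ 1) => //.
    apply: (@measurableT_comp _ _ _ _ _ _ kern) => //; last exact: meas_cont.
    exact: continuous_measurable_fun continuous_kern.
  by move=> x _; rewrite ger0_norm ?kern_le1// ltW// kern_gt0.
- by apply: sub; apply: mk; [case: lp'|case: lq'].
- exact: sub mpq.
- by move=> x _; rewrite lee_fin sqr_ge0.
- by move=> x _; rewrite lee_fin sqr_ge0.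
- move: pp qq; apply: filterS2.
  by move=> x /= h1 h2 x01; rewrite h1// h2.
Qed.

(** The slope is the continuous representative supplied by [H20]: continuity is what upgrades the
    weak derivatives of [v] and of its slope to genuine primitives. *)
Lemma H20_profile v : H20 v -> exists p q, profile v p q /\
  W v = (J 0 1 (fun x => (kern (p x) * q x) ^+ 2))%:E.
Proof.
move=> [cv [[lv [g lg vg]] [lp [h lh ph]]] v01 [p [cp pae] p01]].
have [lp' vp'] := weak_derivative_spec lg vg.
have [lq pq] := weak_derivative_spec lh ph.
have Lp := (L2E _).1 lp'; have Lq := (L2E _).1 lq.
have Lpc := L2_on_cont cp.
have pq' := is_weak_derivative_ae Lp Lpc Lq pae pq.
have Pp := weak_derivative_primitive cp Lq pq'.
have Pv := weak_derivative_primitive cv Lp vp'.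
exists p, (weak_derivative (weak_derivative v)); split; last first.
  by apply: W_kern => //; exact: aeW.
split => // x y x0 xy y1.
rewrite (Pv x y)// -(J_sub x0 xy y1 (L2_on_int Lp)).
rewrite -(J_sub x0 xy y1 (L2_on_int Lpc)).
have J0 z : 0 <= z -> z <= 1 -> J 0 z (weak_derivative v) = J 0 z p.
  move=> z0 z1; rewrite /J /Rintegral; congr fine.
  have sub (k : R -> R) : L2_on 0 1 k ->
      measurable_fun (`]0, z[%classic : set R) (EFin \o k).
    by move=> [mk _]; exact: meas_EFin_oo mk.
  rewrite (@integral_itv_bndoo _ 0 z _ true false); last exact: sub.
  rewrite (@integral_itv_bndoo _ 0 z _ true false); last exact: sub.
  apply: ae_eq_integral => //; [exact: sub|exact: sub|].
  move: pae; apply: filterS.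
  move=> x' /= e x'z; rewrite e//.
  by move: x'z; rewrite /= !in_itv/= => /andP[-> /lt_le_trans]; exact.
by rewrite !J0// ?(le_trans x0)// (le_trans xy).
Qed.

(** Equal primitives force the chosen weak derivatives to agree almost everywhere, first with [p],
    and then, after [p] replaces the chosen slope, with [q]. *)
Lemma profile_H20 v p q : profile v p q -> H20 v /\
  W v = (J 0 1 (fun x => (kern (p x) * q x) ^+ 2))%:E.
Proof.
move=> prof; have [cp cv] := profile_cont prof.
case: prof => lq pq vp v01 p01.
have lp := L2_on_cont cp; have lv := L2_on_cont cv.
have vp' := primitive_weak_derivative lp vp.
have [lp1 vp1] := weak_derivative_spec ((L2E _).2 lp) vp'.
have Lp1 := (L2E _).1 lp1.
have pp : ae_eq mu `]0, 1[%classic (weak_derivative v) p.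
  apply: ae_eq_primitive; [exact: L2_on_int|exact: L2_on_int|].
  move=> x /andP[x0 x1]; rewrite -(vp 0 x)//.
  by rewrite (weak_derivative_primitive cv Lp1 vp1).
have pp' : ae_eq mu `]0, 1[%classic p (weak_derivative v).
  move: pp; apply: filterS.
  by move=> x /= /[apply] ->.
have pq' := is_weak_derivative_ae lp Lp1 lq pp' (primitive_weak_derivative lq pq).
have [lq1 pq1] := weak_derivative_spec ((L2E _).2 lq) pq'.
have Lq1 := (L2E _).1 lq1.
have qq : ae_eq mu `]0, 1[%classic (weak_derivative (weak_derivative v)) q.
  apply: ae_eq_primitive; [exact: L2_on_int|exact: L2_on_int|].
  move=> x /andP[x0 x1]; rewrite -(pq 0 x)//.
  have pq1' := is_weak_derivative_ae Lp1 lp Lq1 pp pq1.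
  by rewrite (weak_derivative_primitive cp Lq1 pq1').
split; last exact: W_kern.
split => //; last by exists p.
split; split => //; first exact/L2E.
  by exists (weak_derivative v).
by exists (weak_derivative (weak_derivative v)).
Qed.

Lemma primitive_is_derive v p x : {within `[0, 1], continuous p} ->
  primitive_on01 v p -> 0 < x < 1 -> is_derive x (1 : R) v (p x).
Proof.
move=> cp vp /andP[x0 x1].
have [cpi _ _] : [/\ {in `]0, 1[, continuous p}, p x @[x --> 0^'+] --> p 0
     & p x @[x --> 1^'-] --> p 1].
  exact/continuous_within_itvP.
have cx : {for x, continuous p} by apply: cpi; rewrite in_itv/= x0.
have [dJ Jp] : derivable (fun y => J 0 y p) x 1 /\
    derive1 (fun y => J 0 y p) x = p x.
  exact: continuous_FTC1_closed x1 (int_on_cont cp) x0 cx.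
have : is_derive x (1 : R) (fun y => v 0 + J 0 y p) (p x).
  rewrite -[p x]add0r; apply: is_deriveD.
  by split; [exact: dJ|rewrite -derive1E; exact: Jp].
apply: near_eq_is_derive; near=> y.
have y0 : 0 < y by near: y; exact: lt_nbhsr.
have y1 : y < 1 by near: y; exact: lt_nbhsl.
by rewrite -(vp 0 y (lexx _) (ltW y0) (ltW y1)) subrKC.
Unshelve. all: by end_near. Qed.

(** With a continuous slope, [v] is classically differentiable inside, so the symmetry can be
    differentiated. *)
Lemma slope_antisym v p x : {within `[0, 1], continuous p} ->
  primitive_on01 v p -> (forall x, x \in `]0, 1[ -> v x = v (1 - x)) ->
  0 < x < 1 -> p (1 - x) = - p x.
Proof.
move=> cp vp vsym /andP[x0 x1].
have x01 : 0 < x < 1 by rewrite x0.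
have x01' : 0 < 1 - x < 1 by apply/andP; split; lra.
have d1 := primitive_is_derive cp vp x01.
have db : is_derive x (1 : R) (fun x => 1 - x) (-1).
  have := is_deriveB (is_derive_cst (1 : R) x 1) (is_derive_id x (1 : R)).
  by move=> /is_derive_eq; apply; rewrite sub0r.
have := @is_derive1_comp R v (fun x => 1 - x) x _ _
  (primitive_is_derive cp vp x01') db.
have : \near x, v x = (v \o (fun x => 1 - x)) x.
  near=> y; apply: vsym; rewrite in_itv/=; apply/andP; split.
    by near: y; exact: lt_nbhsr.
  by near: y; exact: lt_nbhsl.
move=> /near_eq_is_derive/(_ d1)[_ <-] [_ ->].
by rewrite mulrN1 opprK.
Unshelve. all: by end_near. Qed.

(** With A and B the energies on both sides of x, w(x)^2 is at most (x - a) A and (b - x) B.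
    Weighting these by b - x and x - a and adding gives w(x)^2 / 2 <= (x - a)(b - x)(A + B) <= (A +
    B)/16. *)
Lemma energy_half w g a b x : L2_on a b g ->
  (forall x y, a <= x -> x <= y -> y <= b -> w y - w x = J x y g) ->
  w a = 0 -> w b = 0 -> b - a = 2^-1 -> a <= x <= b ->
  8 * w x ^+ 2 <= J a b (fun t => g t ^+ 2).
Proof.
move=> lg wg wa wb ba /andP[ax xb].
have := J_cauchy_schwarz ax (L2_onS (lexx a) xb lg).
have := J_cauchy_schwarz xb (L2_onS ax (lexx b) lg).
rewrite -!wg// wa wb subr0 sub0r sqrrN => hB hA.
rewrite (J_cat ax xb); last by case: lg.
have A0 : 0 <= J a x (fun t => g t ^+ 2) by apply: J_ge0 => t _; exact: sqr_ge0.
have B0 : 0 <= J x b (fun t => g t ^+ 2) by apply: J_ge0 => t _; exact: sqr_ge0.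
move: (J a x _) (J x b _) A0 B0 hA hB => A B A0 B0 hA hB.
have d0 : 0 <= x - a by rewrite subr_ge0.
have e0 : 0 <= b - x by rewrite subr_ge0.
have hA' := ler_wpM2l e0 hA; have hB' := ler_wpM2l d0 hB.
have de : (x - a) * (b - x) <= 16^-1.
  have -> : b - x = 2^-1 - (x - a) by rewrite -ba; ring.
  have := sqr_ge0 (x - a - 4^-1); lra.
have AB0 : 0 <= A + B by rewrite addr_ge0.
have h1 := ler_wpM2r AB0 de.
have h2 : (b - a) * w x ^+ 2 <= (x - a) * (b - x) * (A + B) by lra.
by rewrite ba in h2; lra.
Qed.

(** Each half of [0, 1] contributes 8 w(x)^2, one evaluated at x and the other at 1 - x, where w has
    the same absolute value. *)
Lemma energy_lower_bound w g x : L2_on 0 1 g -> primitive_on01 w g ->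
  w 0 = 0 -> w 2^-1 = 0 -> w 1 = 0 -> w (1 - x) = - w x -> 0 <= x <= 1 ->
  16 * w x ^+ 2 <= J 0 1 (fun t => g t ^+ 2).
Proof.
wlog xh : x / x <= 2^-1 => [hw|].
  move=> lg wg w0 wh w1 ws x01; have [xh|/ltW xh] := leP x 2^-1; first exact: hw.
  rewrite -sqrrN -ws; apply: hw => //.
  - by lra.
  - by rewrite ws opprK; congr w; ring.
  - by case/andP: x01 => x0 x1; apply/andP; split; lra.
move=> lg wg w0 wh w1 ws /andP[x0 x1].
have h0 : 0 <= (2^-1 : R) by rewrite invr_ge0.
have h1 : (2^-1 : R) <= 1 by lra.
rewrite (J_cat h0 h1); last by case: lg.
have := @energy_half w g 0 2^-1 x (L2_onS (lexx _) h1 lg).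
have := @energy_half w g 2^-1 1 (1 - x) (L2_onS h0 (lexx _) lg).
rewrite ws sqrrN w0 w1 wh subr0 x0 xh => e1 e2.
have {}e1 := e1 _ erefl erefl _ _.
have {}e2 := e2 _ erefl erefl erefl isT.
have : 8 * w x ^+ 2 <= J 2^-1 1 (fun t => g t ^+ 2).
  apply: e1.
  - by move=> s t hs st t1; apply: wg => //; exact: le_trans hs.
  - by field.
  - by apply/andP; split; lra.
have : 8 * w x ^+ 2 <= J 0 2^-1 (fun t => g t ^+ 2).
  by apply: e2 => s t s0 st th; apply: wg => //; exact: le_trans h1.
lra.
Qed.

End Profiles.

(** * Inverting G, compactness of almost minimizers, and existence *)

Section Minimizers.
Context {R : realType}.
Implicit Types (f g v w p q psi : R -> R) (a b c x y e K S : R).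
Local Notation J := integral_from_to.

Lemma within_lip w p c : 0 <= c -> {within `[0, 1], continuous w} ->
  (forall x y, 0 <= x <= 1 -> 0 <= y <= 1 -> `|p x - p y| <= c * `|w x - w y|) ->
  {within `[0, 1], continuous p}.
Proof.
move=> c0 /subspace_continuousP cw pw; apply/subspace_continuousP => x x01.
apply/cvgrPdist_lt => e e0.
have ec : 0 < e / (c + 1) by rewrite divr_gt0// ltr_wpDl.
have := cw x x01 => /cvgrPdist_lt/(_ _ ec) hw.
near=> y.
have y01 : `[0, 1]%classic y by near: y; exact: withinT.
have xI : 0 <= x <= 1 by move: x01; rewrite /= in_itv.
have yI : 0 <= y <= 1 by move: y01; rewrite /= in_itv.
apply: le_lt_trans (pw x y xI yI) _.
have : `|w x - w y| < e / (c + 1) by near: y; exact: hw.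
rewrite ltr_pdivlMr ?ltr_wpDl//; apply: le_lt_trans.
by rewrite mulrC ler_wpM2l// lerDl.
Unshelve. all: by end_near. Qed.

Lemma Gfun_primitive p q : L2_on 0 1 q -> primitive_on01 p q ->
  L2_on 0 1 (fun x => kern (p x) * q x) /\
  primitive_on01 (fun x => Gfun (p x)) (fun x => kern (p x) * q x).
Proof.
move=> lq pq.
have cp := primitive_continuous (L2_on_int lq) pq.
have lip x y : 0 <= x <= 1 -> 0 <= y <= 1 ->
    `|kern (p x) - kern (p y)| <= 2 * `|p x - p y|.
  by move=> _ _; exact: kern_lip.
have ck := within_lip (ler0n R 2) cp lip.
split.
  apply: (@L2_on_bounded _ _ _ 1) => //; first exact: meas_cont.
  by move=> x _; rewrite ger0_norm ?kern_le1// ltW// kern_gt0.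
move=> x y x0 xy y1.
have sub : `[x, y] `<=` (`[0, 1]%classic : set R).
  by apply: subset_itv; rewrite bnd_simp.
apply: (@chain_rule R x y (fun x => Gfun (p x)) p q (fun x => kern (p x)) 2 xy) => //.
- exact: L2_onS lq.
- by move=> s t xs st ty; apply: pq => //; [exact: le_trans xs|exact: le_trans y1].
- exact: continuous_subspaceW ck.
- by move=> s t _ _ _; exact: Gfun_taylor.
- by move=> s t _ _ _; exact: kern_lip.
Qed.

(** Here only G(p) is known to be a primitive, so [chain_rule] is used with [f = p] and
    [w = Gfun \o p]. The bound on p keeps 1/kern(p) below 1/k, where k = kern c. Both constants come
    out as 2/k^3: 1/k^2 from the reciprocals, 2 from the Lipschitz bound and 1/k from [Gfun_ge] in
    one case; 1/k times 2 times (1/k)^2 from the Taylor remainder in the other. *)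
Lemma Gfun_primitive_inv p g c : L2_on 0 1 g ->
  (forall x, 0 <= x <= 1 -> `|p x| <= c) ->
  primitive_on01 (fun x => Gfun (p x)) g ->
  L2_on 0 1 (fun x => (kern (p x))^-1 * g x) /\
  primitive_on01 p (fun x => (kern (p x))^-1 * g x).
Proof.
move=> lg pc Gg.
have cG := primitive_continuous (L2_on_int lg) Gg.
pose k := kern c.
have k0 : 0 < k by exact: kern_gt0.
have pG x y : 0 <= x <= 1 -> 0 <= y <= 1 ->
    `|p x - p y| <= k^-1 * `|Gfun (p x) - Gfun (p y)|.
  by move=> /pc xc /pc yc; rewrite ler_pdivlMl//; exact: Gfun_ge.
have kinv x : 0 <= x <= 1 -> (kern (p x))^-1 <= k^-1.
  by move=> /pc xc; rewrite lef_pV2 ?posrE ?kern_gt0//; exact: kern_le.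
have kV0 x : 0 <= (kern (p x))^-1 by rewrite invr_ge0 ltW// kern_gt0.
have kG x y : 0 <= x <= 1 -> 0 <= y <= 1 ->
    `|(kern (p x))^-1 - (kern (p y))^-1| <=
    2 * k^-1 ^+ 3 * `|Gfun (p x) - Gfun (p y)|.
  move=> x01 y01.
  have -> : (kern (p x))^-1 - (kern (p y))^-1 =
      - ((kern (p x))^-1 * (kern (p y))^-1) * (kern (p x) - kern (p y)).
    by field; rewrite !gt_eqF ?kern_gt0.
  have h0 : 0 <= (kern (p x))^-1 * (kern (p y))^-1 by rewrite mulr_ge0.
  rewrite normrM normrN (ger0_norm h0).
  have h1 : (kern (p x))^-1 * (kern (p y))^-1 <= k^-1 * k^-1.
    by rewrite ler_pM// kinv.
  have h2 : `|kern (p x) - kern (p y)| <= 2 * (k^-1 * `|Gfun (p x) - Gfun (p y)|).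
    by apply: le_trans (kern_lip _ _) _; rewrite ler_wpM2l// pG.
  rewrite (le_trans (ler_pM h0 (normr_ge0 _) h1 h2))//.
  by rewrite le_eqVlt; apply/orP; left; apply/eqP; ring.
have c30 : 0 <= 2 * k^-1 ^+ 3 by rewrite mulr_ge0// exprn_ge0// invr_ge0 ltW.
have ck := within_lip c30 cG kG.
split.
  apply: (@L2_on_bounded _ _ _ k^-1) => //; first exact: meas_cont.
  by move=> x x01; rewrite ger0_norm// kinv.
move=> x y x0 xy y1.
have in01 s t : x <= s -> s <= t -> t <= y -> 0 <= s <= 1 /\ 0 <= t <= 1.
  by move=> xs st ty; split; apply/andP; split; lra.
have sub : `[x, y] `<=` (`[0, 1]%classic : set R).
  by apply: subset_itv; rewrite bnd_simp.
apply: (@chain_rule R x y p (fun x => Gfun (p x)) g (fun x => (kern (p x))^-1)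
  (2 * k^-1 ^+ 3) xy) => //.
- exact: L2_onS lg.
- by move=> s t xs st ty; apply: Gg => //; [exact: le_trans xs|exact: le_trans y1].
- exact: continuous_subspaceW ck.
- move=> s t xs st ty; have [s01 t01] := in01 s t xs st ty.
  have -> : p t - p s - (kern (p s))^-1 * (Gfun (p t) - Gfun (p s)) =
      - (kern (p s))^-1 * (Gfun (p t) - Gfun (p s) - kern (p s) * (p t - p s)).
    by field; rewrite gt_eqF ?kern_gt0.
  rewrite normrM normrN (ger0_norm (kV0 s)).
  have h1 := kinv _ s01.
  have h2 : `|Gfun (p t) - Gfun (p s) - kern (p s) * (p t - p s)| <=
      2 * (k^-1 * `|Gfun (p t) - Gfun (p s)|) ^+ 2.
    apply: le_trans (Gfun_taylor _ _) _; rewrite ler_wpM2l//.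
    rewrite -(real_normK (num_real (p t - p s))).
    have h3 := pG t s t01 s01.
    by apply: lerXn2r => //; rewrite nnegrE (le_trans _ h3).
  rewrite (le_trans (ler_pM (kV0 s) (normr_ge0 _) h1 h2))//.
  rewrite exprMn real_normK ?num_real//.
  by rewrite le_eqVlt; apply/orP; left; apply/eqP; ring.
- by move=> s t xs st ty; have [s01 t01] := in01 s t xs st ty; exact: kG.
Qed.

Lemma M_profile psi v : M psi v -> exists p q, [/\ profile v p q,
    W v = (J 0 1 (fun x => (kern (p x) * q x) ^+ 2))%:E &
    forall x, 0 <= x <= 1 ->
      16 * Gfun (p x) ^+ 2 <= J 0 1 (fun x => (kern (p x) * q x) ^+ 2)].
Proof.
move=> [Hv vsym _]; have [p [q [prof WE]]] := H20_profile Hv.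
exists p, q; split => // x x01.
have [cp _] := profile_cont prof.
case: prof => lq pq vp _ [p0 p1].
have [lg Gg] := Gfun_primitive lq pq.
(* The midpoint is fixed by the reflection, so antisymmetry forces a zero there. *)
have ph : p 2^-1 = 0.
  have h01 : 0 < (2^-1 : R) < 1 by apply/andP; split; lra.
  have := slope_antisym cp vp vsym h01.
  by rewrite (_ : 1 - 2^-1 = 2^-1); [lra|field].
apply: (@energy_lower_bound R (fun x => Gfun (p x)) _ x lg Gg) => //=.
- by rewrite p0 Gfun0.
- by rewrite ph Gfun0.
- by rewrite p1 Gfun0.
(* Antisymmetry is known only inside the interval; at the end points it follows from the boundary
   values. *)
case/andP: (x01); rewrite le_eqVlt => /predU1P[<- _|x0].
  by rewrite subr0 p1 p0 Gfun0 oppr0.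
rewrite le_eqVlt => /predU1P[->|x1]; first by rewrite subrr p1 p0 Gfun0 oppr0.
by rewrite (slope_antisym cp vp vsym) ?x0// GfunN.
Qed.

(* Slopes of functions with energy below 4 c0 ^ 2 are bounded, as Gfun stays
   away from its limits - c0 / 2 and c0 / 2. *)
Lemma slope_bound K : 0 <= K -> K < 4 * c0 R ^+ 2 ->
  exists2 c, 0 < c & forall s, 16 * Gfun s ^+ 2 <= K -> `|s| <= c.
Proof.
move=> K0 Kc.
have c00 : 0 <= c0 R.
  by apply: Rintegral_ge0 => x _; rewrite invr_ge0 powR_ge0.
(* The solution of 16 r^2 = K, so that K < 4 c0^2 reads r < c0/2. *)
pose r := Num.sqrt K / 4.
have r0 : 0 <= r by rewrite divr_ge0// sqrtr_ge0.
have r2 : 16 * r ^+ 2 = K by rewrite /r exprMn sqr_sqrtr//; field.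
have rc : r < c0 R / 2.
  rewrite ltNge; apply/negP => cr.
  have h : (c0 R / 2) ^+ 2 <= r ^+ 2 by apply: lerXn2r; rewrite ?nnegrE ?divr_ge0.
  have : K < 16 * (c0 R / 2) ^+ 2 by apply: lt_le_trans Kc _; lra.
  lra.
have [c c_gt0 rG] := Gfun_gt r0 rc.
exists c => // s sK.
have Gr : `|Gfun s| <= r.
  rewrite -(@ler_pXn2r _ 2) ?nnegrE// real_normK ?num_real//; lra.
rewrite leNgt; apply/negP => cs.
have : Gfun c <= `|Gfun s|.
  have [s0|s0] := leP 0 s.
    apply: le_trans (ler_norm _); apply: Gfun_mono.
    by move: cs; rewrite ger0_norm// => /ltW.
  rewrite -normrN -GfunN; apply: le_trans (ler_norm _); apply: Gfun_mono.
  by move: cs; rewrite ltr0_norm// => /ltW.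
by move=> /le_trans/(_ Gr); rewrite leNgt rG.
Qed.

Lemma W_ge0 v : (0 <= W v)%E.
Proof.
apply: integral_ge0 => x _; rewrite lee_fin divr_ge0 ?powR_ge0//.
exact: sqr_ge0.
Qed.

Lemma eq0_of_le x : (forall e, 0 < e -> `|x| <= e) -> x = 0.
Proof.
move=> xe; apply/eqP; rewrite -normr_le0; apply/ler_addgt0Pr => e /xe.
by rewrite add0r.
Qed.

(* The limit slope is a cluster point of the slopes p n. Its energy is bounded
   through the functions Gfun (p n), whose derivatives have bounded L^2 norms;
   the chain rule translates back to the limit slope. *)
Lemma profile_compact K c (d : R) (v p q : nat -> R -> R) : 0 < d ->
  (forall n, profile (v n) (p n) (q n)) ->
  (forall n x, 0 <= x <= 1 -> `|p n x| <= c) ->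
  (forall n, J 0 1 (fun x => (kern (p n x) * q n x) ^+ 2) <= K + d / n.+1%:R) ->
  exists u p' q', [/\ profile u p' q',
    J 0 1 (fun x => (kern (p' x) * q' x) ^+ 2) <= K &
    forall e, 0 < e -> exists n, forall x, 0 <= x <= 1 -> `|v n x - u x| <= e].
Proof.
move=> d0 prof pc enK.
pose g n x := kern (p n x) * q n x.
have lg n : L2_on 0 1 (g n).
  by case: (prof n) => lq pq _ _ _; case: (Gfun_primitive lq pq).
have Gg n : primitive_on01 (fun x => Gfun (p n x)) (g n).
  by case: (prof n) => lq pq _ _ _; case: (Gfun_primitive lq pq).
have p0 n : p n 0 = 0 by case: (prof n) => _ _ _ _ [].
have p1 n : p n 1 = 0 by case: (prof n) => _ _ _ _ [].
have dn n : d / n.+1%:R <= d.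
  by rewrite ler_pdivrMr ?ltr0n// ler_peMr ?ler1n// ltW.
pose k := kern c; have k0 : 0 < k by exact: kern_gt0.
have Kd0 : 0 <= K + d.
  apply: le_trans (le_trans (enK 0%N) _); last by rewrite lerD2l.
  by apply: J_ge0 => x _; exact: sqr_ge0.
(* Cauchy-Schwarz makes G(p n) Hoelder of exponent 1/2 with the energy as constant; [Gfun_ge]
   transfers this to p n at the cost of 1/k^2. *)
have holder n x y : 0 <= x -> x <= y -> y <= 1 ->
    (p n y - p n x) ^+ 2 <= (K + d) / k ^+ 2 * (y - x).
  move=> x0 xy y1; have [_ ig2] := lg n.
  rewrite mulrAC ler_pdivlMr ?exprn_gt0//.
  have h1 : k * `|p n y - p n x| <= `|Gfun (p n y) - Gfun (p n x)|.
    by apply: Gfun_ge; apply: pc; apply/andP; split; lra.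
  have h2 : (k * `|p n y - p n x|) ^+ 2 <= (Gfun (p n y) - Gfun (p n x)) ^+ 2.
    rewrite -(real_normK (num_real (Gfun _ - _))).
    by apply: lerXn2r => //; rewrite nnegrE// mulr_ge0// ltW.
  rewrite -(real_normK (num_real (p n y - _))) mulrC -exprMn.
  apply: le_trans h2 _; rewrite (Gg n x y)//.
  apply: le_trans (J_cauchy_schwarz xy (L2_onS x0 y1 (lg n))) _.
  rewrite mulrC ler_wpM2r ?subr_ge0//.
  apply: le_trans (J_le_sub x0 xy y1 ig2 _) _; first by move=> t _; exact: sqr_ge0.
  by apply: le_trans (enK n) _; rewrite lerD2l.
have L0 : 0 <= (K + d) / k ^+ 2 by rewrite divr_ge0// exprn_ge0// ltW.
have [p' p'P] := equicontinuous_cluster L0 pc holder.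
have p'0 : p' 0 = 0.
  apply: eq0_of_le => e e0; have [n _ /(_ 0)] := p'P e 0%N e0.
  by rewrite lexx ler01 p0 sub0r normrN; exact.
have p'1 : p' 1 = 0.
  apply: eq0_of_le => e e0; have [n _ /(_ 1)] := p'P e 0%N e0.
  by rewrite lexx ler01 p1 sub0r normrN; exact.
have p'c x : 0 <= x <= 1 -> `|p' x| <= c.
  move=> x01; apply/ler_addgt0Pr => e e0.
  have [n _ /(_ x x01) h] := p'P e 0%N e0.
  have := ler_normB (p n x) (p n x - p' x); rewrite subKr.
  by move=> /le_trans; apply; rewrite lerD// pc.
have : forall e, 0 < e -> exists2 h, approximates (fun x => Gfun (p' x)) e h &
    J 0 1 (fun x => h x ^+ 2) <= K + e.
  (* Beyond this index d/(n + 1) <= e; closeness of slopes passes to G with no loss because G is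
     1-Lipschitz. *)
  move=> e e0; have [n Nn hn] := p'P e (Num.truncn (d / e)) e0.
  exists (g n).
    split => // x x01; apply: le_trans (hn x x01); apply: le_trans (Gfun_lip _ _).
    case/andP: x01 => x0 x1.
    by rewrite -(Gg n 0 x)// p0 Gfun0 subr0.
  apply: le_trans (enK n) _; rewrite lerD2l ler_pdivrMr ?ltr0n// mulrC.
  rewrite -ler_pdivrMr//; apply: le_trans (ltW (Num.Theory.truncnS_gt _)) _.
  by rewrite ler_nat ltnS.
move=> /energy_limit[h [lh Gh hK]].
have GP : primitive_on01 (fun x => Gfun (p' x)) h.
  move=> x y x0 xy y1; rewrite (Gh y) ?(Gh x) ?x0 ?y1 ?(le_trans x0)// ?(le_trans xy)//.
  exact: J_sub (L2_on_int lh).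
have [lq' pq'] := Gfun_primitive_inv lh p'c GP.
set q' := fun x => _ in lq' pq'.
have cp' := primitive_continuous (L2_on_int lq') pq'.
have cpn n : {within `[0, 1], continuous (p n)} by case: (profile_cont (prof n)).
pose u x := J 0 x p'.
have up : primitive_on01 u p' by apply: J_primitive; exact: int_on_cont.
have close e : 0 < e -> exists n, forall x, 0 <= x <= 1 -> `|v n x - u x| <= e.
  move=> e0; have [n _ hn] := p'P e 0%N e0; exists n => x /andP[x0 x1].
  have [_ _ vp [v0 _] _] := prof n.
  have -> : v n x = J 0 x (p n) by rewrite -(vp 0 x)// v0 subr0.
  have sub (f : R -> R) : int_on 0 1 f -> int_on 0 x f by exact: int_onS.
  rewrite -JB; [|exact/sub/int_on_cont|exact/sub/int_on_cont].
  apply: (@le_trans _ _ (e * (x - 0))).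
    apply: J_le_norm_cst => //.
      by apply: int_onB; exact/sub/int_on_cont.
    by move=> t /andP[t0 tx]; apply: hn; rewrite t0 (le_trans tx).
  by rewrite subr0 ler_piMr// ltW.
exists u, p', q'; split => //; last first.
  rewrite (@J_eq _ _ _ _ (fun x => h x ^+ 2))// => x _.
  by rewrite /q' mulrA divff ?mul1r// gt_eqF// kern_gt0.
split => //; split; first by rewrite /u J_pt.
apply: eq0_of_le => e /close[n /(_ 1)].
have [_ _ _ [_ ->] _] := prof n.
by rewrite lexx ler01 sub0r normrN; exact.
Qed.

End Minimizers.

Theorem theorem1p1 (R : realType) (psi : R -> R)
  (psi_cont : {within `[0, 1], continuous psi})
  (psi_sym : forall x, x \in `]0, 1[ -> psi x = psi (1 - x))
  (psi_ends : psi 0 = psi 1)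
  (psi0_lt0 : psi 0 < 0)
  (psi_pos : exists2 x0, x0 \in `]0, 1[ & 0 < psi x0)
  (inf_lt : (ereal_inf (W @` M psi) < (4 * c0 R ^+ 2)%:E)%E) :
  exists2 u, M psi u & W u = ereal_inf (W @` M psi).
Proof.
have inf0 : (0 <= ereal_inf (W @` M psi))%E.
  by apply: le_ereal_inf_tmp => _ [v _ <-]; exact: W_ge0.
have inf_fin : ereal_inf (W @` M psi) \is a fin_num.
  (* Finiteness also rules out an empty admissible set, whose infimum would be infinite. *)
  by rewrite ge0_fin_numE// (lt_trans inf_lt)// ltry.
pose K := fine (ereal_inf (W @` M psi)).
have KE : ereal_inf (W @` M psi) = K%:E by rewrite fineK.
have K0 : 0 <= K by rewrite -lee_fin -KE.
have Kc : K < 4 * c0 R ^+ 2 by rewrite -lte_fin -KE.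
(* Half the gap below the threshold: almost minimizers with excess at most d/(n + 1) all have energy
   at most K + d, so a single slope bound [c] serves the whole sequence. *)
pose d := (4 * c0 R ^+ 2 - K) / 2.
have d0 : 0 < d by rewrite divr_gt0// subr_gt0.
have Kdc : K + d < 4 * c0 R ^+ 2 by rewrite /d; lra.
have [c c_gt0 slope_c] := slope_bound (addr_ge0 K0 (ltW d0)) Kdc.
have : forall n : nat, exists vpq : (R -> R) * (R -> R) * (R -> R),
    [/\ M psi vpq.1.1, profile vpq.1.1 vpq.1.2 vpq.2,
     forall x, 0 <= x <= 1 -> `|vpq.1.2 x| <= c &
     integral_from_to 0 1 (fun x => (kern (vpq.1.2 x) * vpq.2 x) ^+ 2) <=
       K + d / n.+1%:R].
  move=> n.
  have dn0 : 0 < d / n.+1%:R by rewrite divr_gt0// ltr0n.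
  have [_ [v Mv <-] vK] := lb_ereal_inf_adherent dn0 inf_fin.
  have [p [q [prof WE bound]]] := M_profile Mv.
  have en : integral_from_to 0 1 (fun x => (kern (p x) * q x) ^+ 2) <= K + d / n.+1%:R.
    by move: vK; rewrite KE WE -EFinD lte_fin => /ltW.
  exists (v, p, q); split => //= x x01; apply: slope_c.
  apply: le_trans (bound x x01) _; apply: le_trans en _; rewrite lerD2l.
  by rewrite ler_pdivrMr ?ltr0n// ler_peMr ?ler1n// ltW.
move=> /choice[s sP].
have [u [p [q [prof enK close]]]] := @profile_compact R K c d
  (fun n => (s n).1.1) (fun n => (s n).1.2) (fun n => (s n).2) d0
  (fun n => let: And4 _ h _ _ := sP n in h) (fun n => let: And4 _ _ h _ := sP n in h)
  (fun n => let: And4 _ _ _ h := sP n in h).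
have [Hu WE] := profile_H20 prof.
(* Symmetry and the obstacle condition survive uniform approximation; since [u] is only a cluster
   point, a suitable index is chosen anew for each tolerance. *)
have Mu : M psi u.
  split => //.
    move=> x; rewrite in_itv/= => /andP[x0 x1].
    apply/eqP; rewrite -subr_eq0; apply/eqP/eq0_of_le => e e0.
    have [n hn] := close (e / 2) (divr_gt0 e0 (ltr0n _ 2)).
    have [[_ vsym _] _ _ _] := sP n.
    have h1 := hn x; have h2 := hn (1 - x).
    rewrite -vsym ?in_itv/= ?x0// in h2.
    rewrite (_ : u x - _ = ((s n).1.1 x - u (1 - x)) - ((s n).1.1 x - u x)); last by ring.
    rewrite (le_trans (ler_normB _ _))//.
    have {}h1 : `|(s n).1.1 x - u x| <= e / 2 by apply: h1; rewrite !ltW.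
    have {}h2 : `|(s n).1.1 x - u (1 - x)| <= e / 2.
      by apply: h2; apply/andP; split; lra.
    lra.
  move=> x x01; apply/ler_addgt0Pr => e e0.
  have [n hn] := close e e0.
  have [[_ _ vpsi] _ _ _] := sP n.
  have := vpsi x x01; move: x01; rewrite in_itv/= => /andP[x0 x1].
  have : `|(s n).1.1 x - u x| <= e by apply: hn; rewrite !ltW.
  by rewrite ler_norml => /andP[_]; lra.
exists u => //; apply/eqP; rewrite eq_le; apply/andP; split.
  by rewrite KE WE lee_fin.
by apply: ereal_inf_lbound; exists u.
Qed.
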